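(* Let $d,n,k\ge1$. The monoid $\mathrm{TM}(\mathbb{Z}^d,n,k)$ and the group $\mathrm{RTM}(\mathbb{Z}^d,n,k)$ are recursively presented and have decidable word problems in the standard presentations, i.e. when elements are presented by local rules.
   Context: Let $\Sigma=\{0,\dots,n-1\}$, $Q=\{1,\dots,k\}$. Let $X_k=\{y\in\{0,1,\dots,k\}^{\mathbb{Z}^d} : y_{\vec u}\ne0\text{ and }y_{\vec v}\neq 0\implies \vec u=\vec v\}$ and $X_{n,k}=\Sigma^{\mathbb{Z}^d}\times X_k$. Given finite $F,F'\subset\mathbb{Z}^d$ and $f:\Sigma^F\times Q\to\Sigma^{F'}\times Q\times\mathbb{Z}^d$ (a local rule), the map $T_f:X_{n,k}\to X_{n,k}$ is defined by: $T_f(x,y)=(x,y)$ if $y$ is identically $0$; otherwise let $\vec v$ be the unique position with $q=y_{\vec v}\ne 0$, let $p\in\Sigma^F$ with $p_{\vec u}=x_{\vec v+\vec u}$, and $f(p,q)=(p',q',\vec e)$; then $T_f(x,y)=(\tilde x,\tilde y)$ with $\tilde x_{\vec t}=p'_{\vec t-\vec v}$ if $\vec t-\vec v\in F'$, $\tilde x_{\vec t}=x_{\vec t}$ otherwise, and $\tilde y_{\vec v+\vec e}=q'$, $\tilde y_{\vec t}=0$ for $\vec t\ne\vec v+\vec e$. Such maps are the $(d,n,k)$-Turing machines; they form the monoid $\mathrm{TM}(\mathbb{Z}^d,n,k)$ under composition. One is reversible if it has a two-sided inverse that is a $(d,n,k)$-Turing machine; the reversible ones form the group $\mathrm{RTM}(\mathbb{Z}^d,n,k)$.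 A group (or monoid) is called recursively presented if one can algorithmically enumerate its elements (here: local rules presenting them), and all identities that hold between them. It has a decidable word problem if one can furthermore decide whether a given identity between (products of) presented elements holds. *)

(* Defs.v *)
From HB Require Import structures.
From mathcomp Require Import all_boot all_order all_algebra.
From mathcomp Require Import finmap boolp.
From Stdlib Require Cantor.
Set Implicit Arguments.
Unset Strict Implicit.
Unset Printing Implicit Defensive.

Import GRing.Theory.
Local Open Scope ring_scope.

(** * Turing machines in the moving-head model *)

Definition vec (d : nat) := 'rV[int]_d.

Definition state (k : nat) := {q : 'I_k.+1 | q != ord0}.

(* The space X_{n,k}; the value 0 of [head] means "no head here". *)
Record config (d n k : nat) := Config {
  tape : vec d -> 'I_n;
  head : vec d -> 'I_k.+1;
  headP : forall u v : vec d, head u != ord0 -> head v != ord0 -> u = v }.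

Record local_rule (d n k : nat) := LocalRule {
  read_set : {fset vec d};
  write_set : {fset vec d};
  rule_map :> {ffun read_set -> 'I_n} * state k ->
              {ffun write_set -> 'I_n} * state k * vec d }.

Lemma single_headP (d k : nat) (w : vec d) (q : 'I_k.+1) (u v : vec d) :
  (if u == w then q else ord0) != ord0 ->
  (if v == w then q else ord0) != ord0 -> u = v.
Proof. by case: (u =P w) => [->|]; case: (v =P w) => [->|]; rewrite ?eqxx. Qed.

Definition with_head (d n k : nat) (x : vec d -> 'I_n) (w : vec d)
    (q : state k) : config d n k :=
  Config x (@single_headP d k w (val q)).

Definition pattern_at (d n : nat) (F : {fset vec d}) (x : vec d -> 'I_n)
    (v : vec d) : {ffun F -> 'I_n} :=
  [ffun u : F => x (v + val u)].

(* [insub] tests whether [t - v] lies in [G]. *)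
Definition overwrite (d n : nat) (G : {fset vec d}) (x : vec d -> 'I_n)
    (v : vec d) (p : {ffun G -> 'I_n}) : vec d -> 'I_n :=
  fun t => if (insub (t - v) : option G) is Some u then p u else x t.

(* The map T_f. *)
Definition run (d n k : nat) (f : local_rule d n k) (c : config d n k) :
    config d n k :=
  match pselect (exists v, head c v != ord0) with
  | left ex =>
      let v := xchoose ex in
      let q : state k := Sub (head c v) (xchooseP ex) in
      let: (p', q', e) := f (pattern_at (read_set f) (tape c) v, q) in
      with_head (overwrite (tape c) v p') (v + e) q'
  | right _ => c
  end.

Lemma config_ext (d n k : nat) (c c' : config d n k) :
  tape c =1 tape c' -> head c =1 head c' -> c = c'.
Proof.
case: c c' => x y Hy [x' y' Hy'] /= /funext ex /funext ey; subst x' y'.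
by rewrite (Prop_irrelevance Hy Hy').
Qed.

Lemma headless_or_with_head (d n k : nat) (c : config d n k) :
  (forall v, head c v = ord0) \/ (exists v q, c = with_head (tape c) v q).
Proof.
have [[v hv]|nh] := pselect (exists v, head c v != ord0); last first.
  by left=> v; apply/eqP/negPn/negP => hv; apply: nh; exists v.
right; exists v, (Sub (head c v) hv); apply: config_ext => //= u.
by case: eqP => [->//|nuv]; apply/eqP/negPn/negP => hu; exact/nuv/(headP hu hv).
Qed.

Lemma run_headless (d n k : nat) (f : local_rule d n k) (c : config d n k) :
  (forall v, head c v = ord0) -> run f c = c.
Proof.
by move=> h0; rewrite /run; case: pselect => // ex; case: (ex) => v /eqP[].
Qed.

Lemma run_with_head (d n k : nat) (f : local_rule d n k) x v q :
  run f (with_head x v q) =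
  let r := f (pattern_at (read_set f) x v, q) in
  with_head (overwrite x v r.1.1) (v + r.2) r.1.2.
Proof.
rewrite /run; case: pselect => [ex|[]]; last first.
  by exists v; rewrite /= eqxx (valP q).
have ev : xchoose ex = v.
  by have /= := xchooseP ex; case: (xchoose ex =P v).
have eq : Sub (head (with_head x v q) (xchoose ex)) (xchooseP ex) = q :> state k.
  by apply: val_inj; rewrite SubK /= ev eqxx.
by rewrite eq ev /=; case: (f _) => -[].
Qed.

Definition id_rule (d n k : nat) : local_rule d n k :=
  @LocalRule d n k fset0 fset0 (fun a => (a, 0)).

Lemma run_id (d n k : nat) : run (id_rule d n k) = id.
Proof.
apply/funext => c; have [/run_headless->//|[v [q ->]]] := headless_or_with_head c.
rewrite run_with_head /= addr0; congr with_head; apply/funext => t.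
by rewrite /overwrite; case: insub => // -[].
Qed.

Lemma run_comp (d n k : nat) (g f : local_rule d n k) :
  exists h : local_rule d n k, run g \o run f = run h.
Proof.
case: n g f => [|n] g f.
  by exists f; apply/funext => c; case: (tape c 0).
pose ms := [seq (f a).2 | a <- enum [set: {ffun read_set f -> 'I_n.+1} * state k]].
pose W := seq_fset tt (read_set f ++ write_set f ++
  [seq e + u | e <- ms, u <- (read_set g ++ write_set g : seq (vec d))]).
have rfW u : u \in read_set f -> u \in W by rewrite seq_fsetE !mem_cat => ->.
have wfW u : u \in write_set f -> u \in W.
  by rewrite seq_fsetE !mem_cat => ->; rewrite orbT.
have gW a u : (u \in read_set g) || (u \in write_set g) -> (f a).2 + u \in W.
  move=> ug; rewrite seq_fsetE !mem_cat; apply/orP; right; apply/orP; right.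
  by apply: allpairs_f; [apply: map_f; rewrite mem_enum inE | rewrite mem_cat].
pose ext (p : {ffun W -> 'I_n.+1}) (t : vec d) : 'I_n.+1 :=
  if (insub t : option W) is Some u then p u else ord0.
have extE x v t : t \in W -> ext (pattern_at W x v) t = x (v + t).
  by move=> tW; rewrite /ext insubT ffunE.
pose r1 (x : vec d -> 'I_n.+1) v q := f (pattern_at (read_set f) x v, q).
pose r2 (x : vec d -> 'I_n.+1) v q := let r := r1 x v q in
  g (pattern_at (read_set g) (overwrite x v r.1.1) (v + r.2), r.1.2).
pose fin (x : vec d -> 'I_n.+1) v q :=
  overwrite (overwrite x v (r1 x v q).1.1) (v + (r1 x v q).2) (r2 x v q).1.1.
exists (@LocalRule d n.+1 k W W (fun a => let x := ext a.1 in
  (pattern_at W (fin x 0 a.2) 0, (r2 x 0 a.2).1.2, (r1 x 0 a.2).2 + (r2 x 0 a.2).2))).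
apply/funext => c /=; have [h0|[v [q ->]]] := headless_or_with_head c.
  by rewrite !run_headless.
move: (tape c) => {c} x; rewrite !run_with_head /= -/(r1 x v q) -/(r2 x v q) -/(fin x v q).
set x0 := ext _.
have e1 : r1 x0 0 q = r1 x v q.
  rewrite /r1; congr (f (_, _)); apply/ffunP => u; rewrite !ffunE add0r.
  exact/extE/rfW/valP.
have ow t : t \in W ->
    overwrite x0 0 (r1 x v q).1.1 t = overwrite x v (r1 x v q).1.1 (v + t).
  move=> tW; rewrite /overwrite subr0 (addrC v) addrK.
  by case: insub => // ; rewrite addrC; exact: extE.
have e2 : r2 x0 0 q = r2 x v q.
  rewrite /r2 e1; congr (g (_, _)); apply/ffunP => u; rewrite !ffunE add0r -addrA.
  by apply/ow/gW; rewrite (valP u).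
rewrite e2 e1 -addrA; congr with_head; apply/funext => t.
rewrite [in RHS]/overwrite /=; case: insubP => [u tW eu|tW].
  rewrite ffunE add0r /fin e1 e2 eu.
  rewrite [LHS]/overwrite [RHS]/overwrite add0r opprD addrA.
  by case: insub => //; rewrite ow ?subrKC // -eu ?valP.
rewrite /fin {1}/overwrite opprD addrA; case: insubP => [u tg eu|_].
  by case/negP: tW; rewrite -[_ - v](subrK (r1 x v q).2) addrC gW // tg orbT.
by rewrite /overwrite; case: insubP => // u /wfW tf; rewrite tf in tW.
Qed.

Record TM (d n k : nat) := MkTM {
  tm_fun :> config d n k -> config d n k;
  tm_funP : exists f : local_rule d n k, tm_fun = run f }.

HB.instance Definition _ (d n k : nat) := gen_eqMixin (TM d n k).
HB.instance Definition _ (d n k : nat) := gen_choiceMixin (TM d n k).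

Lemma TM_inj (d n k : nat) (a b : TM d n k) : tm_fun a = tm_fun b -> a = b.
Proof.
by case: a b => a Ha [b Hb] /= e; subst b; rewrite (Prop_irrelevance Ha Hb).
Qed.

Lemma tm_compP (d n k : nat) (a b : TM d n k) :
  exists f : local_rule d n k, tm_fun a \o tm_fun b = run f.
Proof.
by case: (tm_funP a) (tm_funP b) => [g ->] [f ->]; exact: run_comp.
Qed.

Definition tm_comp (d n k : nat) (a b : TM d n k) : TM d n k :=
  MkTM (tm_compP a b).

Definition tm_id (d n k : nat) : TM d n k :=
  MkTM (ex_intro _ (id_rule d n k) (esym (run_id d n k))).

Fact tm_compA (d n k : nat) : associative (@tm_comp d n k).
Proof. by move=> a b c; exact: TM_inj. Qed.
Fact tm_comp1m (d n k : nat) : left_id (tm_id d n k) (@tm_comp d n k).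
Proof. by move=> a; exact: TM_inj. Qed.
Fact tm_compm1 (d n k : nat) : right_id (tm_id d n k) (@tm_comp d n k).
Proof. by move=> a; exact: TM_inj. Qed.

HB.instance Definition _ (d n k : nat) :=
  isMonoid.Build (TM d n k) (@tm_compA d n k) (@tm_comp1m d n k)
    (@tm_compm1 d n k).

Record RTM (d n k : nat) := MkRTM {
  rtm_tm :> TM d n k;
  rtm_tmP : exists b : TM d n k, (rtm_tm * b = 1 /\ b * rtm_tm = 1)%g }.

HB.instance Definition _ (d n k : nat) := gen_eqMixin (RTM d n k).
HB.instance Definition _ (d n k : nat) := gen_choiceMixin (RTM d n k).

Lemma RTM_inj (d n k : nat) (a b : RTM d n k) : rtm_tm a = rtm_tm b -> a = b.
Proof.
by case: a b => a Ha [b Hb] /= e; subst b; rewrite (Prop_irrelevance Ha Hb).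
Qed.

Lemma rtm_mulP (d n k : nat) (a b : RTM d n k) :
  exists c : TM d n k,
    ((rtm_tm a * rtm_tm b) * c = 1 /\ c * (rtm_tm a * rtm_tm b) = 1)%g.
Proof.
case: (rtm_tmP a) (rtm_tmP b) => [a' [aa' a'a]] [b' [bb' b'b]].
exists (b' * a')%g; split.
  by rewrite mulgA -(mulgA _ _ b') bb' mulg1.
by rewrite mulgA -(mulgA b') a'a mulg1.
Qed.

Lemma rtm_oneP (d n k : nat) :
  exists c : TM d n k, (1 * c = 1 /\ c * 1 = 1)%g.
Proof. by exists 1%g; rewrite mulg1. Qed.

Lemma rtm_invP (d n k : nat) (a : RTM d n k) :
  exists c : TM d n k, (projT1 (cid (rtm_tmP a)) * c = 1 /\
                        c * projT1 (cid (rtm_tmP a)) = 1)%g.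
Proof. by case: cid => b [ab ba] /=; exists a. Qed.

Definition rtm_mul (d n k : nat) (a b : RTM d n k) := MkRTM (rtm_mulP a b).
Definition rtm_one (d n k : nat) := MkRTM (rtm_oneP d n k).
Definition rtm_inv (d n k : nat) (a : RTM d n k) := MkRTM (rtm_invP a).

Fact rtm_mulA (d n k : nat) : associative (@rtm_mul d n k).
Proof. by move=> a b c; apply: RTM_inj; exact: mulgA. Qed.
Fact rtm_mul1m (d n k : nat) : left_id (rtm_one d n k) (@rtm_mul d n k).
Proof. by move=> a; apply: RTM_inj; exact: mul1g. Qed.
Fact rtm_mulm1 (d n k : nat) : right_id (rtm_one d n k) (@rtm_mul d n k).
Proof. by move=> a; apply: RTM_inj; exact: mulg1. Qed.
Fact rtm_mulVm (d n k : nat) :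
  left_inverse (rtm_one d n k) (@rtm_inv d n k) (@rtm_mul d n k).
Proof. by move=> a; apply: RTM_inj => /=; case: cid => b []. Qed.
Fact rtm_mulmV (d n k : nat) :
  right_inverse (rtm_one d n k) (@rtm_inv d n k) (@rtm_mul d n k).
Proof. by move=> a; apply: RTM_inj => /=; case: cid => b []. Qed.

HB.instance Definition _ (d n k : nat) :=
  isGroup.Build (RTM d n k) (@rtm_mulA d n k) (@rtm_mul1m d n k)
    (@rtm_mulm1 d n k) (@rtm_mulVm d n k) (@rtm_mulmV d n k).

(** * Algorithms: partial recursive functions *)

Local Open Scope nat_scope.

Definition cpair (a b : nat) : nat := Cantor.to_nat (a, b).

(* Unary partial recursive functions, with Cantor's pairing to simulate
   several arguments. *)
Inductive prog : Type :=
  | PZero | PSucc | PLeft | PRight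
  | PPair of prog & prog
  | PComp of prog & prog
  | PRec of prog & prog
  | PMu of prog.

(* [eval p x y]: the program p halts on the input x with the output y. *)
Inductive eval : prog -> nat -> nat -> Prop :=
  | EZero x : eval PZero x 0
  | ESucc x : eval PSucc x x.+1
  | ELeft a b : eval PLeft (cpair a b) a
  | ERight a b : eval PRight (cpair a b) b
  | EPair p q x y z : eval p x y -> eval q x z ->
      eval (PPair p q) x (cpair y z)
  | EComp p q x y z : eval q x y -> eval p y z -> eval (PComp p q) x z
  | ERec0 p q a y : eval p a y -> eval (PRec p q) (cpair a 0) y
  | ERecS p q a m y z : eval (PRec p q) (cpair a m) y ->
      eval q (cpair a (cpair m y)) z -> eval (PRec p q) (cpair a m.+1) z
  | EMu p a m (r : nat -> nat) :
      (forall i, i < m -> eval p (cpair a i) (r i).+1) ->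
      eval p (cpair a m) 0 -> eval (PMu p) a m.

(* Recursively enumerable: the range of a partial recursive function. *)
Definition enumerable (A : nat -> Prop) : Prop :=
  exists p : prog, forall y, A y <-> exists x, eval p x y.

Fixpoint code_seq (s : seq nat) : nat :=
  if s is x :: s' then (cpair x (code_seq s')).+1 else 0.

(** * Recursive presentations and word problems *)

(* [nu c a] means that the number c presents the element a. *)
Definition presentation (M : Type) (nu : nat -> M -> Prop) : Prop :=
  (forall c a b, nu c a -> nu c b -> a = b) /\ (forall a, exists c, nu c a).

Fixpoint monoid_word (M : monoidType) (nu : nat -> M -> Prop)
    (w : seq nat) (a : M) : Prop :=
  if w is c :: w' then
    exists b b', [/\ nu c b, monoid_word nu w' b' & a = (b * b')%g]
  else a = 1%g.

Definition monoid_recursively_presented (M : monoidType)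
    (nu : nat -> M -> Prop) : Prop :=
  [/\ presentation nu,
      enumerable (fun c => exists a, nu c a)
    & enumerable (fun y => exists u v : seq nat,
        y = cpair (code_seq u) (code_seq v) /\
        exists a, monoid_word nu u a /\ monoid_word nu v a)].

(* As in any word problem, the input is promised to be a pair of words in the
   presented elements. *)
Definition monoid_decidable_word_problem (M : monoidType)
    (nu : nat -> M -> Prop) : Prop :=
  exists p : prog, forall (u v : seq nat) (a b : M),
    monoid_word nu u a -> monoid_word nu v b ->
    let x := cpair (code_seq u) (code_seq v) in
    (a = b -> eval p x 1) /\ (a <> b -> eval p x 0).

(* A letter (true, c) stands for the inverse of the element presented by c. *)
Fixpoint group_word (G : groupType) (nu : nat -> G -> Prop)
    (w : seq (bool * nat)) (a : G) : Prop :=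
  if w is (s, c) :: w' then
    exists b b', [/\ nu c b, group_word nu w' b'
                   & a = ((if s then b^-1 else b) * b')%g]
  else a = 1%g.

Definition code_group_word (w : seq (bool * nat)) : nat :=
  code_seq [seq cpair (nat_of_bool l.1) l.2 | l <- w].

Definition group_recursively_presented (G : groupType)
    (nu : nat -> G -> Prop) : Prop :=
  [/\ presentation nu,
      enumerable (fun c => exists a, nu c a)
    & enumerable (fun y => exists u v : seq (bool * nat),
        y = cpair (code_group_word u) (code_group_word v) /\
        exists a, group_word nu u a /\ group_word nu v a)].

Definition group_decidable_word_problem (G : groupType)
    (nu : nat -> G -> Prop) : Prop :=
  exists p : prog, forall (u v : seq (bool * nat)) (a b : G),
    group_word nu u a -> group_word nu v b ->
    let x := cpair (code_group_word u) (code_group_word v) in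
    (a = b -> eval p x 1) /\ (a <> b -> eval p x 0).

(** * Presentation by local rules *)

Definition code_int (z : int) : nat :=
  match z with Posz m => m.*2 | Negz m => m.*2.+1 end.

Definition code_vec (d : nat) (v : vec d) : nat :=
  code_seq [seq code_int (v ord0 i) | i <- enum 'I_d].

Definition code_pattern (T : finType) (n : nat) (s : seq T)
    (p : {ffun T -> 'I_n}) : nat :=
  code_seq [seq val (p u) | u <- s].

(* The line of the table of f for the argument a, patterns being listed in the
   order of the enumerations s and s' of the read and write sets. *)
Definition code_line (d n k : nat) (f : local_rule d n k)
    (s : seq (read_set f)) (s' : seq (write_set f))
    (a : {ffun read_set f -> 'I_n} * state k) : nat :=
  let: (p, q) := a in
  let: (p', q', e) := f a in
  cpair (cpair (code_pattern s p) (val (val q)))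
        (cpair (cpair (code_pattern s' p') (val (val q'))) (code_vec e)).

Definition enumerates (T : finType) (s : seq T) : Prop :=
  uniq s /\ forall u, u \in s.

(* A code of f lists its read set, its write set and the graph of f, each
   without repetition and in an arbitrary order. *)
Definition codes_rule (d n k : nat) (c : nat) (f : local_rule d n k) : Prop :=
  exists (s : seq (read_set f)) (s' : seq (write_set f))
         (t : seq ({ffun read_set f -> 'I_n} * state k)),
    [/\ enumerates s, enumerates s', enumerates t
      & c = cpair (cpair (code_seq [seq code_vec (val u) | u <- s])
                         (code_seq [seq code_vec (val u) | u <- s']))
                  (code_seq [seq code_line s s' a | a <- t])].

Definition presents_TM (d n k : nat) (c : nat) (a : TM d n k) : Prop :=
  exists2 f : local_rule d n k, codes_rule c f & tm_fun a = run f.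

Definition presents_RTM (d n k : nat) (c : nat) (a : RTM d n k) : Prop :=
  presents_TM c (rtm_tm a).

(* Main.v *)
Require Import Defs.
From mathcomp Require Import all_boot all_order all_algebra.
From mathcomp Require Import finmap boolp.
From mathcomp Require Import zify.
From Stdlib Require Cantor.
Set Implicit Arguments.
Unset Strict Implicit.
Unset Printing Implicit Defensive.

(* The action of a product of local rules is local: started at the origin, it
   only looks at and only changes the cells of a finite window computed from the
   read sets, the write sets and the moves of the factors. As it also commutes
   with translations, two products are equal iff they give the same result on
   all the patterns on the union of their windows, which is a finite check.

   An inverse letter of a word in the group is replaced by a rule found by
   unbounded search: a rule is accepted when its products with the letter, in
   both orders, act trivially. The search halts when the letter presents a
   reversible machine, so that the word problem reduces to that of the monoid;
   its results also serve as certificates in the enumerations. *)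

Import GRing.Theory.

(** Programs handle bare numbers while machines act on infinite tapes, so every notion occurs twice:
    on lists, where computability is proved, and on machines, where algebra is done. [represents]
    and [spells] tie the two together. The parameters [d], [n], [k] are fixed before a program is
    chosen and act as constants in it. Being a code of a local rule is a finite check on a table,
    but reversibility is never decided here: it is only confirmed by exhibiting an inverse, and no
    bound on the size of an inverse is established. Semi-decidability is enough. Enumerations may
    diverge on bad inputs, and the word problem promises reversible letters, whose inverses have
    local rules by the definition of reversibility. The answer does not depend on which inverse the
    search finds, since two-sided inverses are unique. *)

(** * Recursive functions on coded types *)

Definition cfst (c : nat) : nat := (Cantor.of_nat c).1.
Definition csnd (c : nat) : nat := (Cantor.of_nat c).2.

Lemma cfstE a b : cfst (cpair a b) = a.
Proof. by rewrite /cfst /cpair Cantor.cancel_of_to. Qed.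

Lemma csndE a b : csnd (cpair a b) = b.
Proof. by rewrite /csnd /cpair Cantor.cancel_of_to. Qed.

Lemma cpairE c : cpair (cfst c) (csnd c) = c.
Proof. by rewrite /cpair -surjective_pairing Cantor.cancel_to_of. Qed.

Lemma leq_csnd c : csnd c <= c.
Proof.
have := Cantor.to_nat_non_decreasing (cfst c) (csnd c).
by have := cpairE c; rewrite /cpair; lia.
Qed.

Lemma leq_cpairr a b : b <= cpair a b.
Proof. by rewrite -{1}(csndE a b) leq_csnd. Qed.

Lemma eval_left x : eval PLeft x (cfst x).
Proof. by rewrite -{1}(cpairE x); constructor. Qed.

Lemma eval_right x : eval PRight x (csnd x).
Proof. by rewrite -{1}(cpairE x); constructor. Qed.

Lemma eval_rec p q a m (r : nat -> nat) :
  eval p a (r 0) ->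
  (forall i, i < m -> eval q (cpair a (cpair i (r i))) (r i.+1)) ->
  eval (PRec p q) (cpair a m) (r m).
Proof.
move=> e0; elim: m => [|m IH] eS; first exact: ERec0.
by apply: ERecS (eS _ (ltnSn m)); apply: IH => i lt_im; apply/eS/ltnW.
Qed.

(** Stated as a [match] on the program because inputs such as [cpair a m] are not constructor terms:
    plain inversion would leave equations between codes, which are solved here once and for all by
    [cfst] and [csnd]. *)
Lemma eval_inv p x y : eval p x y ->
  match p with
  | PZero => y = 0
  | PSucc => y = x.+1
  | PLeft => y = cfst x
  | PRight => y = csnd x
  | PPair p q => exists y1 y2, [/\ eval p x y1, eval q x y2 & y = cpair y1 y2]
  | PComp p q => exists2 z, eval q x z & eval p z y
  | PRec p q =>
      if csnd x is m.+1 then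
        exists2 z, eval (PRec p q) (cpair (cfst x) m) z
                 & eval q (cpair (cfst x) (cpair m z)) y
      else eval p (cfst x) y
  | PMu p =>
      eval p (cpair x y) 0 /\ forall i, i < y -> exists r, eval p (cpair x i) r.+1
  end.
Proof.
by case=> *; rewrite ?cfstE ?csndE //; by [eexists; eauto | do 2 eexists; split; eauto].
Qed.

(** For [PMu], the smaller of two distinct results would make the inner program output both zero and
    a successor on the same input. *)
Lemma eval_det p x y z : eval p x y -> eval p x z -> y = z.
Proof.
elim: p x y z => [||||p IHp q IHq|p IHp q IHq|p IHp q IHq|p IHp] x y z.
1-4: by move=> /eval_inv -> /eval_inv ->.
- move=> /eval_inv[y1 [y2 [p1 q1 ->]]] /eval_inv[z1 [z2 [p2 q2 ->]]].
  by rewrite (IHp _ _ _ p1 p2) (IHq _ _ _ q1 q2).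
- move=> /eval_inv[y1 q1 p1] /eval_inv[z1 q2 p2].
  by move: p1; rewrite (IHq _ _ _ q1 q2) => /IHp /(_ p2).
- rewrite -(cpairE x); elim: (csnd x) y z => [|m IH] y z.
    by move=> /eval_inv + /eval_inv; rewrite cfstE csndE; apply: IHp.
  move=> /eval_inv + /eval_inv; rewrite cfstE csndE => -[y1 r1 q1] [z1 r2 q2].
  by move: q1; rewrite (IH _ _ r1 r2) => /IHq /(_ q2).
- move=> /eval_inv[y0 ylt] /eval_inv[z0 zlt]; case: (ltngtP y z) => // lt.
  + by have [r er] := zlt _ lt; have := IHp _ _ _ y0 er.
  + by have [r er] := ylt _ lt; have := IHp _ _ _ z0 er.
Qed.

(** * Types coded by numbers *)

Class coded (T : Type) := Coded
  { enc : T -> nat; dec : nat -> T; encK : cancel enc dec }.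

(** Every number is a code, so quantifying over numbers is quantifying over [T]. No such instance is
    given for [bool], which is why the sign of a group letter is later stored as a number. *)
Class numbering (T : Type) (c : coded T) := decK : cancel (@dec T c) (@enc T c).

Lemma enc_inj (T : Type) (c : coded T) : injective (@enc T c).
Proof. exact: can_inj (@encK T c). Qed.

#[export] Instance coded_nat : coded nat := @Coded nat id id (fun _ => erefl).

#[export] Instance numbering_nat : numbering coded_nat := fun _ => erefl.

Lemma bool_encK : cancel nat_of_bool (leq 1).
Proof. by case. Qed.

#[export] Instance coded_bool : coded bool := Coded bool_encK.

Section Products.
Context (A B : Type) {cA : coded A} {cB : coded B}.

Definition prod_enc (x : A * B) : nat := cpair (enc x.1) (enc x.2).
Definition prod_dec (c : nat) : A * B := (dec (cfst c), dec (csnd c)).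

Lemma prod_encK : cancel prod_enc prod_dec.
Proof. by case=> a b; rewrite /prod_dec cfstE csndE !encK. Qed.

#[export] Instance coded_prod : coded (A * B) := Coded prod_encK.

#[export] Instance numbering_prod {nA : numbering cA} {nB : numbering cB} :
  numbering coded_prod.
Proof. by move=> c; rewrite /enc/= /prod_enc /= !decK cpairE. Qed.

End Products.

Lemma enc_pair (A B : Type) {cA : coded A} {cB : coded B} (x : A) (y : B) :
  enc (x, y) = cpair (enc x) (enc y).
Proof. by []. Qed.

Section Sequences.
Context (A : Type) {cA : coded A}.

Definition seq_enc (s : seq A) : nat := code_seq (map enc s).

(** [csnd c] is not a subterm of [c.+1], hence the fuel; the code itself is enough fuel by
    [leq_csnd]. *)
Fixpoint seq_dec_fuel (m c : nat) : seq A :=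
  match m, c with
  | m'.+1, c'.+1 => dec (cfst c') :: seq_dec_fuel m' (csnd c')
  | _, _ => [::]
  end.

Definition seq_dec (c : nat) : seq A := seq_dec_fuel c c.

Lemma seq_dec_fuelE m m' c : c <= m -> c <= m' ->
  seq_dec_fuel m c = seq_dec_fuel m' c.
Proof.
elim: m m' c => [|m IH] [|m'] [|c] //= lt lt'.
by rewrite (IH m') // (leq_trans (leq_csnd c)).
Qed.

Lemma seq_encK : cancel seq_enc seq_dec.
Proof.
elim=> // x s IH; rewrite /seq_dec /= cfstE csndE encK; congr cons.
rewrite -[RHS]IH; by apply: seq_dec_fuelE => //; apply: leq_cpairr.
Qed.

#[export] Instance coded_seq : coded (seq A) := Coded seq_encK.

#[export] Instance numbering_seq {nA : numbering cA} : numbering coded_seq.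
Proof.
move=> c; rewrite /enc/= /dec/= /seq_dec; move: {2 3}c (leqnn c) => m.
elim: m c => [|m IH] [|c] //= lt; rewrite /seq_enc /= decK.
by rewrite -/(seq_enc _) IH ?cpairE // (leq_trans (leq_csnd c)).
Qed.

Lemma enc_cons x (s : seq A) : enc (x :: s) = (cpair (enc x) (enc s)).+1.
Proof. by []. Qed.

(** Lets the code of a sequence serve as the number of rounds of a loop over it. *)
Lemma size_enc (s : seq A) : size s <= enc s.
Proof.
elim: s => // x s IH; rewrite enc_cons ltnS (leq_trans IH _) //; exact: leq_cpairr.
Qed.

End Sequences.

(** * Closure properties of total computable functions *)

Definition computable (A B : Type) {cA : coded A} {cB : coded B} (f : A -> B) :=
  exists p, forall a, eval p (enc a) (enc (f a)).

Section Closure.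
Context (A B C : Type) {cA : coded A} {cB : coded B} {cC : coded C}.

Lemma computable_ext (f g : A -> B) : f =1 g -> computable f -> computable g.
Proof. by move=> e [p ep]; exists p => a; rewrite -e. Qed.

Lemma computable_id : computable (fun a : A => a).
Proof.
(* [prog] has no identity program; recombining the two components yields one because Cantor's
   pairing is onto. *)
exists (PPair PLeft PRight) => a; rewrite -[X in eval _ _ X]cpairE.
by constructor; [apply: eval_left | apply: eval_right].
Qed.

Lemma computable_const (b : B) : computable (fun _ : A => b).
Proof.
exists (iter (enc b) (PComp PSucc) PZero) => a.
elim: (enc b) => [|m IH] /=; first by constructor.
by apply: EComp IH _; constructor.
Qed.

Lemma computable_comp (g : B -> C) (f : A -> B) :
  computable g -> computable f -> computable (fun a => g (f a)).
Proof. by move=> [p ep] [q eq]; exists (PComp p q) => a; apply: EComp. Qed.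

Lemma computable_pair (f : A -> B) (g : A -> C) :
  computable f -> computable g -> computable (fun a => (f a, g a)).
Proof. by move=> [p ep] [q eq]; exists (PPair p q) => a; constructor. Qed.

Lemma computable_fst (f : A -> B * C) :
  computable f -> computable (fun a => (f a).1).
Proof.
by move=> [p ep]; exists (PComp PLeft p) => a; apply: EComp (ep a) _; constructor.
Qed.

Lemma computable_snd (f : A -> B * C) :
  computable f -> computable (fun a => (f a).2).
Proof.
by move=> [p ep]; exists (PComp PRight p) => a; apply: EComp (ep a) _; constructor.
Qed.

Lemma computable_succ (f : A -> nat) :
  computable f -> computable (fun a => (f a).+1).
Proof.
by move=> [p ep]; exists (PComp PSucc p) => a; apply: EComp (ep a) _; constructor.
Qed.

(** Typed form of primitive recursion. The round number is passed to [h] because the predecessor and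
    [iota] are computed from it. *)
Lemma computable_iteri (m : A -> nat) (h : A -> nat -> B -> B) (g : A -> B) :
  computable m -> computable (fun x : A * (nat * B) => h x.1 x.2.1 x.2.2) ->
  computable g -> computable (fun a => iteri (m a) (fun i b => h a i b) (g a)).
Proof.
move=> [pm em] [ph eh] [pg eg]; have [pid eid] := computable_id.
exists (PComp (PRec pg ph) (PPair pid pm)) => a.
apply: EComp; first by constructor; [apply: eid | apply: em].
apply: (eval_rec (r := fun m => enc (iteri m (h a) (g a)))) => //= i _.
exact: (eh (a, (i, iteri i (h a) (g a)))).
Qed.

Lemma computable_nat_of_bool (b : A -> bool) :
  computable b -> computable (fun a => nat_of_bool (b a)).
Proof. by []. Qed.

Lemma computable_cons (x : A -> B) (s : A -> seq B) :
  computable x -> computable s -> computable (fun a => x a :: s a).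
Proof.
move=> [p ep] [q eq]; exists (PComp PSucc (PPair p q)) => a.
by apply: EComp; [constructor; [apply: ep | apply: eq] | constructor].
Qed.

End Closure.

(** Unbounded search runs over numbers; this lets it range over a coded type such as that of
    certificates. *)
Lemma computable_dec (A : Type) {cA : coded A} {nA : numbering cA} :
  computable (@dec A cA).
Proof.
have [p ep] := @computable_id nat _; exists p => c.
by rewrite decK; apply: ep.
Qed.

Lemma computable2 (A B C D : Type) {cA : coded A} {cB : coded B} {cC : coded C}
    {cD : coded D} (F : B -> C -> D) (f : A -> B) (g : A -> C) :
  computable (fun x : B * C => F x.1 x.2) -> computable f -> computable g ->
  computable (fun a => F (f a) (g a)).
Proof.
move=> cF cf cg.
exact: (computable_comp (f := fun a => (f a, g a)) cF (computable_pair cf cg)).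
Qed.

Lemma computable3 (A B C D E : Type) {cA : coded A} {cB : coded B} {cC : coded C}
    {cD : coded D} {cE : coded E} (F : B -> C -> D -> E)
    (f : A -> B) (g : A -> C) (h : A -> D) :
  computable (fun x : B * (C * D) => F x.1 x.2.1 x.2.2) ->
  computable f -> computable g -> computable h ->
  computable (fun a => F (f a) (g a) (h a)).
Proof.
move=> cF cf cg ch; apply: (computable_comp (f := fun a => (f a, (g a, h a))) cF).
exact/computable_pair/computable_pair.
Qed.

Lemma computable_iter (A B : Type) {cA : coded A} {cB : coded B} (m : A -> nat)
    (h : A -> B -> B) (g : A -> B) :
  computable m -> computable (fun x : A * B => h x.1 x.2) -> computable g ->
  computable (fun a => iter (m a) (fun b => h a b) (g a)).
Proof.
move=> cm ch cg.
apply: (@computable_ext _ _ _ _ (fun a => iteri (m a) (fun _ b => h a b) (g a))).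
  by move=> a; elim: (m a) => //= i ->.
apply: (computable_iteri (h := fun a _ b => h a b)) => //.
apply: computable2 ch _ _; first exact/computable_fst/computable_id.
exact/computable_snd/computable_snd/computable_id.
Qed.

(** A conditional is a loop run once or not at all. Both branches are total, so evaluating the wrong
    one is harmless. *)
Lemma computable_if (A B : Type) {cA : coded A} {cB : coded B}
    (b : A -> bool) (f g : A -> B) :
  computable b -> computable f -> computable g ->
  computable (fun a => if b a then f a else g a).
Proof.
move=> cb cf cg; apply: (@computable_ext _ _ _ _
    (fun a => iter (b a) (fun=> f a) (g a))); first by move=> a; case: (b a).
apply: (computable_iter (h := fun a _ => f a)) => //.
exact/(computable_comp cf)/computable_fst/computable_id.
Qed.

Lemma computable_pred (A : Type) {cA : coded A} (f : A -> nat) :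
  computable f -> computable (fun a => (f a).-1).
Proof.
move=> cf; apply: (@computable_ext _ _ _ _
  (fun a => iteri (f a) (fun i _ => i) 0)); first by move=> a; case: (f a).
apply: (computable_iteri (h := fun _ i _ => i)) => //; last exact: computable_const.
exact/computable_fst/computable_snd/computable_id.
Qed.

Lemma computable_case (A B C : Type) {cA : coded A} {cB : coded B} {cC : coded C}
    (s : A -> seq B) (f : A -> B -> seq B -> C) (g : A -> C) :
  computable s ->
  computable (fun x : A * (B * seq B) => f x.1 x.2.1 x.2.2) -> computable g ->
  computable (fun a => if s a is x :: s' then f a x s' else g a).
Proof.
move=> [ps es] [pf ef] [pg eg].
have [ppred epred] := computable_pred (@computable_id nat _).
(* [PRec] is run up to [sgn] and not up to the code of the sequence, as the
   program of [f] may diverge on numbers that are not codes. *)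
pose sgn := PComp (PRec PZero (PComp PSucc PZero)) (PPair ps ps).
have esgn a : eval sgn (enc a) (nat_of_bool (~~ nilp (s a))).
  apply: EComp; first by constructor; apply: es.
  case: (s a) => [|x s']; first by apply: ERec0; constructor.
  rewrite enc_cons.
  apply: (eval_rec (r := fun m => nat_of_bool (0 < m))); first by constructor.
  by move=> i _; apply: EComp; constructor.
(* The code of [x :: s'] is the successor of the code of [(x, s')], so a predecessor splits the
   sequence; with counter 0 the recursion stops at [g a]. *)
exists (PComp (PRec pg (PComp pf (PPair PLeft (PComp (PComp ppred ps) PLeft))))
   (PPair (PPair PLeft PRight) sgn)) => a.
apply: EComp.
  constructor; last exact: esgn.
  by constructor; [apply: eval_left | apply: eval_right].
rewrite cpairE; have := es a; case: (s a) => [|x s'] e /=; first exact: ERec0.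
apply: ERecS; first exact: ERec0.
apply: EComp (ef (a, (x, s'))).
constructor; first by constructor.
by apply: EComp; [constructor | apply: EComp e _; apply: epred].
Qed.

Lemma computable_foldl (A B C : Type) {cA : coded A} {cB : coded B} {cC : coded C}
    (f : A -> C -> B -> C) (z : A -> C) (s : A -> seq B) :
  computable (fun x : A * (C * B) => f x.1 x.2.1 x.2.2) -> computable z ->
  computable s -> computable (fun a => foldl (fun c b => f a c b) (z a) (s a)).
Proof.
move=> cf cz cs.
(* [step] is stationary once the sequence is exhausted, so any number of rounds that bounds the
   length gives the fold. *)
pose step a (w : C * seq B) :=
  if w.2 is x :: s' then (f a w.1 x, s') else (w.1, [::]).
apply: (@computable_ext _ _ _ _
    (fun a => (iter (enc (s a)) (step a) (z a, s a)).1)).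
  move=> a; set m := enc _; have: size (s a) <= m by exact: size_enc.
  by elim: m (z a) (s a) => [|m IH] y [|x t] // lt; rewrite iterSr; apply: IH.
apply: computable_fst; apply: (computable_iter (h := step)) => //; last first.
  exact: computable_pair.
have i3 := @computable_id (A * (C * seq B)) _.
apply: (computable_case (s := fun x : A * (C * seq B) => x.2.2)
  (f := fun x b s' => (f x.1 x.2.1 b, s')) (g := fun x => (x.2.1, [::]))).
- exact/computable_snd/computable_snd.
- have i5 := @computable_id (A * (C * seq B) * (B * seq B)) _.
  apply: computable_pair; last exact/computable_snd/computable_snd.
  apply: (computable3 cf).
  + exact/computable_fst/computable_fst.
  + exact/computable_fst/computable_snd/computable_fst.
  + exact/computable_fst/computable_snd.
- apply: computable_pair; last exact: computable_const.
  exact/computable_fst/computable_snd.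
Qed.

Lemma computable_rev (A B : Type) {cA : coded A} {cB : coded B} (s : A -> seq B) :
  computable s -> computable (fun a => rev (s a)).
Proof.
move=> cs; apply: (@computable_ext _ _ _ _
  (fun a => foldl (fun t x => x :: t) [::] (s a))).
  move=> a; rewrite -[s a in LHS]revK foldl_rev.
  by elim: (rev _) => //= x t ->.
apply: (computable_foldl (f := fun _ t x => x :: t)) => //; last exact: computable_const.
by apply: computable_cons;
  [exact/computable_snd/computable_snd/computable_id
  |exact/computable_fst/computable_snd/computable_id].
Qed.

Lemma computable_foldr (A B C : Type) {cA : coded A} {cB : coded B} {cC : coded C}
    (f : A -> B -> C -> C) (z : A -> C) (s : A -> seq B) :
  computable (fun x : A * (B * C) => f x.1 x.2.1 x.2.2) -> computable z ->
  computable s -> computable (fun a => foldr (fun b c => f a b c) (z a) (s a)).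
Proof.
move=> cf cz cs; apply: (@computable_ext _ _ _ _
  (fun a => foldl (fun c b => f a b c) (z a) (rev (s a)))).
  by move=> a; rewrite foldl_rev.
have i3 := @computable_id (A * (C * B)) _.
apply: (computable_foldl (f := fun a c b => f a b c)) => //; last exact: computable_rev.
apply: (computable3 cf); first exact/computable_fst.
  exact/computable_snd/computable_snd.
exact/computable_fst/computable_snd.
Qed.

(** A hook, redefined once the lemmas on arithmetic and sequences are available. *)
Ltac computable_user := fail.

(** Computability facts in the context are tried before the syntax of the function, so functions
    already treated serve as primitives. *)
Ltac computable_tac := repeat (cbv beta; first [ eassumption
  | match goal with H : computable ?m |- computable (fun a => ?m (@?f a)) =>
      apply: (computable_comp (f := f) H) end
  | match goal with H : computable (fun x => ?F x.1 x.2) |-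
        computable (fun a => ?F (@?f a) (@?g a)) =>
      apply: (computable2 (f := f) (g := g) H) end
  | lazymatch goal with
  | |- computable (fun a => a) => exact: computable_id
  | |- computable (fun _ => ?c) => exact: computable_const
  | |- computable (fun _ => (_, _)) => apply: computable_pair
  | |- computable (fun _ => fst _) => apply: computable_fst
  | |- computable (fun _ => snd _) => apply: computable_snd
  | |- computable (fun _ => _.+1) => apply: computable_succ
  | |- computable (fun _ => _.-1) => apply: computable_pred
  | |- computable (fun _ => _ :: _) => apply: computable_cons
  | |- computable (fun _ => if _ then _ else _) => apply: computable_if
  | |- computable (fun _ => nat_of_bool _) => apply: computable_nat_of_bool
  | |- computable (fun _ => iter _ _ _) => apply: computable_iter
  | |- computable (fun _ => iteri _ _ _) => apply: computable_iteri
  | |- computable (fun _ => foldr _ _ _) => apply: computable_foldr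
  | |- computable (fun _ => foldl _ _ _) => apply: computable_foldl
  | |- computable (fun _ => rev _) => apply: computable_rev
  | |- computable (fun _ => _) => computable_user
  | |- computable ?f => change (computable (fun a => f a))
  end]).

(** * Arithmetic and boolean operations *)

Section Arithmetic.
Context (A : Type) {cA : coded A}.

Lemma computable_negb (b : A -> bool) :
  computable b -> computable (fun a => ~~ b a).
Proof.
move=> cb; apply: (@computable_ext _ _ _ _ (fun a => if b a then false else true)).
  by move=> a; case: (b a).
computable_tac.
Qed.

Lemma computable_andb (b c : A -> bool) :
  computable b -> computable c -> computable (fun a => b a && c a).
Proof.
move=> cb cc; apply: (@computable_ext _ _ _ _ (fun a => if b a then c a else false)).
  by [].
computable_tac.
Qed.

Lemma computable_addn (m n : A -> nat) :
  computable m -> computable n -> computable (fun a => m a + n a).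
Proof.
move=> cm cn; apply: (@computable_ext _ _ _ _
    (fun a => iter (m a) (fun i => i.+1) (n a))).
  by move=> a; elim: (m a) => //= i ->.
computable_tac.
Qed.

Lemma computable_subn (m n : A -> nat) :
  computable m -> computable n -> computable (fun a => m a - n a).
Proof.
move=> cm cn; apply: (@computable_ext _ _ _ _
    (fun a => iter (n a) (fun i => i.-1) (m a))).
  by move=> a; elim: (n a) => [|i] /=; rewrite ?subn0 // subnS => ->.
computable_tac.
Qed.

Lemma computable_leq (m n : A -> nat) :
  computable m -> computable n -> computable (fun a => m a <= n a).
Proof.
move=> cm cn; apply: (@computable_ext _ _ _ _
    (fun a => iter (m a - n a) (fun=> false) true)).
  by move=> a; rewrite -subn_eq0; case: (m a - n a).
by apply: (computable_iter (h := fun _ _ => false));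
  [exact: computable_subn | computable_tac..].
Qed.

Lemma computable_odd (m : A -> nat) :
  computable m -> computable (fun a => odd (m a)).
Proof.
move=> cm; apply: (@computable_ext _ _ _ _
    (fun a => iter (m a) (fun b => if b then false else true) false)).
  by move=> a; elim: (m a) => //= i ->; case: odd.
computable_tac.
Qed.

Lemma computable_eqn (m n : A -> nat) :
  computable m -> computable n -> computable (fun a => m a == n a).
Proof.
move=> cm cn; apply: (@computable_ext _ _ _ _
    (fun a => (m a <= n a) && (n a <= m a))).
  by move=> a; rewrite eqn_leq.
by apply: computable_andb; apply: computable_leq.
Qed.

End Arithmetic.

(** * Operations on sequences *)

Section Lists.
Context (A B C : Type) {cA : coded A} {cB : coded B} {cC : coded C}.

Lemma computable_cat (s t : A -> seq B) :
  computable s -> computable t -> computable (fun a => s a ++ t a).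
Proof.
move=> cs ct; apply: (@computable_ext _ _ _ _
    (fun a => foldr (fun x s' => x :: s') (t a) (s a))).
  by move=> a; elim: (s a) => //= x s' ->.
computable_tac.
Qed.

Lemma computable_map (f : A -> B -> C) (s : A -> seq B) :
  computable (fun x : A * B => f x.1 x.2) -> computable s ->
  computable (fun a => map (fun b => f a b) (s a)).
Proof.
move=> cf cs; apply: (computable_foldr (f := fun a x s' => f a x :: s')) => //.
  by apply: computable_cons; [apply: (computable2 cf)|]; computable_tac.
computable_tac.
Qed.

Lemma computable_all (b : A -> B -> bool) (s : A -> seq B) :
  computable (fun x : A * B => b x.1 x.2) -> computable s ->
  computable (fun a => all (fun x => b a x) (s a)).
Proof.
move=> cb cs; apply: (computable_foldr (f := fun a x r => b a x && r)) => //.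
  by apply: computable_andb; [apply: (computable2 cb)|]; computable_tac.
computable_tac.
Qed.

End Lists.

Section MoreLists.
Context (A B C : Type) {cA : coded A} {cB : coded B} {cC : coded C}.

Lemma computable_has (b : A -> B -> bool) (s : A -> seq B) :
  computable (fun x : A * B => b x.1 x.2) -> computable s ->
  computable (fun a => has (fun x => b a x) (s a)).
Proof.
move=> cb cs; apply: (@computable_ext _ _ _ _
    (fun a => ~~ all (fun x => ~~ b a x) (s a))).
  by move=> a; rewrite -has_predC; apply: eq_has => x /=; rewrite negbK.
by apply/computable_negb/computable_all => //; apply: computable_negb.
Qed.

Lemma computable_flatten (s : A -> seq (seq B)) :
  computable s -> computable (fun a => flatten (s a)).
Proof.
move=> cs; apply: (computable_foldr (f := fun _ s t => s ++ t)) => //.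
  by apply: computable_cat; computable_tac.
computable_tac.
Qed.

Lemma computable_size (s : A -> seq B) :
  computable s -> computable (fun a => size (s a)).
Proof.
move=> cs; apply: (@computable_ext _ _ _ _ (fun a => foldr (fun _ i => i.+1) 0 (s a))).
  by move=> a; elim: (s a) => //= x s' ->.
computable_tac.
Qed.

Lemma computable_iota (m n : A -> nat) :
  computable m -> computable n -> computable (fun a => iota (m a) (n a)).
Proof.
move=> cm cn; apply: (@computable_ext _ _ _ _
    (fun a => rev (iteri (n a) (fun i s => m a + i :: s) [::]))).
  move=> a; apply: (can_inj revK); rewrite revK.
  elim: (n a) => // i IH.
  by rewrite -[in RHS]addn1 iotaD rev_cat /= IH.
apply: computable_rev; apply: (computable_iteri (h := fun a i s => m a + i :: s)) => //.
  apply: computable_cons; last by computable_tac.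
  by apply: computable_addn; [apply: computable_comp cm _|]; computable_tac.
computable_tac.
Qed.

Lemma computable_zip (s : A -> seq B) (t : A -> seq C) :
  computable s -> computable t -> computable (fun a => zip (s a) (t a)).
Proof.
move=> cs ct.
(* The accumulator holds what is left of [t] and the pairs formed so far, last one first. *)
pose f (w : seq C * seq (B * C)) x :=
  if w.1 is y :: t' then (t', (x, y) :: w.2) else ([::], w.2).
apply: (@computable_ext _ _ _ _ (fun a => rev (foldl f (t a, [::]) (s a)).2)).
  move=> a; rewrite -[RHS]/([::] ++ _) -[[::] in RHS]/(rev [::]).
  elim: (s a) (t a) [::] => [|x s' IH] [|y t'] w /=; rewrite ?cats0 //.
    by rewrite IH; case: (s') => [|? ?]; rewrite cats0.
  by rewrite IH rev_cons cat_rcons.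
apply/computable_rev/computable_snd.
apply: (computable_foldl (f := fun _ => f)); try by computable_tac.
apply: (computable_case (s := fun x : A * (seq C * seq (B * C) * B) => x.2.1.1)
  (f := fun x y t' => (t', (x.2.2, y) :: x.2.1.2))
  (g := fun x => ([::], x.2.1.2))); computable_tac.
Qed.

End MoreLists.

Lemma computable_enc (A B : Type) {cA : coded A} {cB : coded B} (f : A -> B) :
  computable f -> computable (fun a => enc (f a)).
Proof. by []. Qed.

Lemma computable_eq (A : Type) (B : eqType) {cA : coded A} {cB : coded B}
    (f g : A -> B) :
  computable f -> computable g -> computable (fun a => f a == g a).
Proof.
move=> cf cg; apply: (@computable_ext _ _ _ _ (fun a => enc (f a) == enc (g a))).
  by move=> a; apply/eqP/eqP => [|->//]; apply: enc_inj.
by apply: computable_eqn; apply: computable_enc.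
Qed.

Lemma computable_mem (A : Type) (B : eqType) {cA : coded A} {cB : coded B}
    (x : A -> B) (s : A -> seq B) :
  computable x -> computable s -> computable (fun a => x a \in s a).
Proof.
move=> cx cs; apply: (@computable_ext _ _ _ _ (fun a => has (fun y => y == x a) (s a))).
  by move=> a; rewrite -has_pred1; apply: eq_has.
apply: (computable_has (b := fun a y => y == x a)) => //.
by apply: computable_eq; [|apply: computable_comp cx _]; computable_tac.
Qed.

Lemma computable_uniq (A : Type) (B : eqType) {cA : coded A} {cB : coded B}
    (s : A -> seq B) :
  computable s -> computable (fun a => uniq (s a)).
Proof.
(* A fold only sees the result on the tail, whereas [uniq] also inspects the tail; so the tail is
   rebuilt along with the answer. *)
move=> cs; apply: (@computable_ext _ _ _ _ (fun a =>
    (foldr (fun x r => (x :: r.1, (~~ (x \in r.1)) && r.2)) ([::], true) (s a)).2)).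
  move=> a; set f := (X in foldr X).
  suff -> t : foldr f ([::], true) t = (t, uniq t) by [].
  by elim: t => //= x t ->.
apply: computable_snd.
apply: (computable_foldr (f := fun _ x r => (x :: r.1, ~~ (x \in r.1) && r.2))) => //.
  apply: computable_pair; first by computable_tac.
  apply: computable_andb; last by computable_tac.
  by apply: computable_negb; apply: computable_mem; computable_tac.
computable_tac.
Qed.

Ltac computable_user ::= lazymatch goal with
  | |- computable (fun _ => ~~ _) => apply: computable_negb
  | |- computable (fun _ => _ && _) => apply: computable_andb
  | |- computable (fun _ => _ + _) => apply: computable_addn
  | |- computable (fun _ => _ - _) => apply: computable_subn
  | |- computable (fun _ => _ <= _) => apply: computable_leq
  | |- computable (fun _ => odd _) => apply: computable_odd
  | |- computable (fun _ => _ == _) => apply: computable_eq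
  | |- computable (fun _ => _ \in _) => apply: computable_mem
  | |- computable (fun _ => uniq _) => apply: computable_uniq
  | |- computable (fun _ => _ ++ _) => apply: computable_cat
  | |- computable (fun _ => map _ _) => apply: computable_map
  | |- computable (fun _ => all _ _) => apply: computable_all
  | |- computable (fun _ => flatten _) => apply: computable_flatten
  | |- computable (fun _ => size _) => apply: computable_size
  | |- computable (fun _ => iota _ _) => apply: computable_iota
  | |- computable (fun _ => zip _ _) => apply: computable_zip
  end.

(** The first half makes a search halt when a witness exists; the second says that whatever is
    output stems from a witness, which excludes spurious elements of an enumerated set. *)
Lemma computable_minimization (A B : Type) {cA : coded A} {cB : coded B}
    (r : A -> nat -> bool) (g : A -> nat -> B) :
  computable (fun x : A * nat => r x.1 x.2) ->
  computable (fun x : A * nat => g x.1 x.2) ->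
  exists p, forall a,
    ((exists m, r a m) -> exists2 m, r a m & eval p (enc a) (enc (g a m))) /\
    (forall y, eval p (enc a) y -> exists2 m, r a m & y = enc (g a m)).
Proof.
(* [PMu] looks for a zero, and the code of [~~ r a m] is 0 exactly when [r a m] holds. *)
move=> /computable_negb[pr er] [pg eg].
exists (PComp pg (PPair (PPair PLeft PRight) (PMu pr))) => a.
have eid : eval (PPair PLeft PRight) (enc a) (enc a).
  rewrite -[X in eval _ _ X]cpairE.
  by constructor; [apply: eval_left | apply: eval_right].
have min_r m : r a m -> (forall i, i < m -> ~~ r a i) -> eval (PMu pr) (enc a) m.
  move=> ram lt; apply: (EMu (r := fun=> 0)); last first.
    by have := er (a, m); rewrite /= ram.
  by move=> i /lt nri; have := er (a, i); rewrite /= nri.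
have ev m : r a m -> (forall i, i < m -> ~~ r a i) ->
    eval (PComp pg (PPair (PPair PLeft PRight) (PMu pr))) (enc a) (enc (g a m)).
  by move=> ram lt; apply: EComp (eg (a, m)); apply: EPair eid _; apply: min_r.
split=> [ex|y].
  have ram := ex_minnP ex; case: ram => m ram lt; exists m => //.
  by apply: ev => // i; apply: contraTN => /lt; rewrite -leqNgt.
move=> /eval_inv[z /eval_inv[y1 [m [e1 em ->]]] eg'].
rewrite (eval_det e1 eid) in eg' => {y1 e1}.
have ram : r a m.
  have [e0 _] := eval_inv em; have := eval_det (er (a, m)) e0.
  by case: (r a m) => //=.
by exists m => //; apply: eval_det eg' (eg (a, m)).
Qed.

(* A set is enumerated by the program that maps the code of [(y, m)] to the
   code of [y] when [m] certifies [y], and diverges otherwise. *)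
Lemma enumerable_projection (A B : Type) {cA : coded A} {cB : coded B}
    {nA : numbering cA} {nB : numbering cB} (r : A -> B -> bool) :
  computable (fun x : A * B => r x.1 x.2) ->
  enumerable (fun y => exists m, r (dec y) m).
Proof.
move=> cr.
(* The test is constant in the search variable, so the search halts at once or never: this turns a
   boolean test into a domain of definition. *)
have [||p pP] := @computable_minimization (A * B) A _ _ (fun x _ => r x.1 x.2)
    (fun x _ => x.1); [by apply: (computable2 cr); computable_tac | by computable_tac |].
exists p => y; split=> [[m rm]|[x]].
  exists (enc (dec y : A, m)).
  have [/(_ (ex_intro _ 0 rm)) [_ _] /=] := pP (dec y, m).
  by rewrite decK.
have xE : enc (dec x : A * B) = x by exact: decK.
by rewrite -xE => /(proj2 (pP _)) [_ rx ->]; rewrite encK; exists (dec x : A * B).2.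
Qed.

(** * Simulation of local rules *)

(** An even code [a] stands for a/2 and an odd one for -(a+1)/2; the cases are the sum of two
    integers read directly on these codes. *)
Definition int_code_add (a b : nat) : nat :=
  if odd a then
    if odd b then (a + b).+1 else if a < b then (b - a).-1 else a - b
  else if odd b then if b < a then (a - b).-1 else b - a else a + b.

Definition vec_code_add (v w : seq nat) : seq nat :=
  [seq int_code_add x.1 x.2 | x <- zip v w].

(** The first entry for a key wins, so a cell is overwritten by prepending an entry. *)
Definition assoc (K : eqType) (V : Type) (z : V) (x : K) (s : seq (K * V)) : V :=
  foldr (fun y r => if y.1 == x then y.2 else r) z s.

(* An association list, giving the tape on finitely many cells. *)
Notation tape_code := (seq (seq nat * nat)).
Notation line_code := ((seq nat * nat) * ((seq nat * nat) * seq nat))%type.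
Notation rule_code := ((seq (seq nat) * seq (seq nat)) * seq line_code)%type.
Notation config_code := (tape_code * (seq nat * nat))%type.

(** The table of a rule lists all its inputs, so the default is only met on malformed data. *)
Definition rule_output (r : rule_code) (c : config_code) : (seq nat * nat) * seq nat :=
  assoc (([::], 0), [::])
    ([seq assoc 0 (vec_code_add c.2.1 u) c.1 | u <- r.1.1], c.2.2) r.2.

Definition step (r : rule_code) (c : config_code) : config_code :=
  (zip [seq vec_code_add c.2.1 u | u <- r.1.2] (rule_output r c).1.1 ++ c.1,
   (vec_code_add c.2.1 (rule_output r c).2, (rule_output r c).1.2)).

Definition steps (w : seq rule_code) (c : config_code) : config_code :=
  foldr (fun r c => step r c) c w.

(** Minkowski sum of two finite sets of coded vectors. *)
Definition sums (s t : seq (seq nat)) : seq (seq nat) :=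
  [seq vec_code_add v w | v <- s, w <- t].

(* The codes of the possible displacements of the head under a word. *)
Definition reach (d : nat) (w : seq rule_code) : seq (seq nat) :=
  foldr (fun r s => sums s [seq l.2.2 | l <- r.2]) [:: nseq d 0] w.

(** The first letter of a word acts last: [r] is applied after a displacement in [reach d w'], and
    touches its read and write cells translated by it. *)
Fixpoint window (d : nat) (w : seq rule_code) : seq (seq nat) :=
  if w is r :: w' then sums (reach d w') (r.1.1 ++ r.1.2) ++ window d w'
  else [::].

(* [window] by structural recursion, carrying [reach] along. *)
Definition reach_window (d : nat) (w : seq rule_code) :=
  foldr (fun (r : rule_code) s => (sums s.1 [seq l.2.2 | l <- r.2],
     sums s.1 (r.1.1 ++ r.1.2) ++ s.2)) ([:: nseq d 0], [::]) w.

Definition patterns (n m : nat) : seq (seq nat) :=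
  iter m (fun s => [seq x :: p | x <- iota 0 n, p <- s]) [:: [::]].

Definition same_result (u v : seq rule_code) (W : seq (seq nat)) (c : config_code) :=
  ((steps u c).2 == (steps v c).2) &&
  all (fun t => assoc 0 t (steps u c).1 == assoc 0 t (steps v c).1) W.

(** The window may list a cell twice. As the first entry wins in [assoc], a pattern with conflicting
    values still describes a tape, so such extra tests are harmless. *)
Definition same_action (d n k : nat) (u v : seq rule_code) : bool :=
  all (fun p => all (fun q =>
    same_result u v (window d u ++ window d v)
      (zip (window d u ++ window d v) p, (nseq d 0, q))) (iota 1 k))
    (patterns n (size (window d u ++ window d v))).

Definition table_inputs (n k m : nat) : seq (seq nat * nat) :=
  [seq (p, q) | p <- patterns n m, q <- iota 1 k].

(** Distinct keys and inclusion both ways make the table the graph of a function on all inputs. The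
    pattern and state of an output have the shape of an input over the write set, hence the second
    use of [table_inputs]. *)
Definition valid_rule (d n k : nat) (r : rule_code) : bool :=
  (uniq r.1.1 && uniq r.1.2 && all (fun v => size v == d) (r.1.1 ++ r.1.2)) &&
  (uniq [seq l.1 | l <- r.2] &&
   all (fun x => x \in [seq l.1 | l <- r.2]) (table_inputs n k (size r.1.1)) &&
   all (fun l => [&& l.1 \in table_inputs n k (size r.1.1),
                     l.2.1 \in table_inputs n k (size r.1.2)
                   & size l.2.2 == d]) r.2).

(** * Computability of the simulation *)

Lemma computable_assoc (A V : Type) (K : eqType) {cA : coded A} {cK : coded K}
    {cV : coded V} (z : A -> V) (x : A -> K) (s : A -> seq (K * V)) :
  computable z -> computable x -> computable s ->
  computable (fun a => assoc (z a) (x a) (s a)).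
Proof. rewrite /assoc => cz cx cs; computable_tac. Qed.

Lemma computable_int_code_add :
  computable (fun x : nat * nat => int_code_add x.1 x.2).
Proof. rewrite /int_code_add; computable_tac. Qed.

Lemma computable_vec_code_add :
  computable (fun x : seq nat * seq nat => vec_code_add x.1 x.2).
Proof.
have cI := computable_int_code_add; rewrite /vec_code_add; computable_tac.
Qed.

Lemma computable_sums :
  computable (fun x : seq (seq nat) * seq (seq nat) => sums x.1 x.2).
Proof. have cV := computable_vec_code_add; rewrite /sums; computable_tac. Qed.

Lemma computable_rule_output :
  computable (fun x : rule_code * config_code => rule_output x.1 x.2).
Proof.
have cV := computable_vec_code_add; rewrite /rule_output.
apply: computable_assoc; computable_tac.
apply: computable_assoc; computable_tac.
Qed.

Lemma computable_step :
  computable (fun x : rule_code * config_code => step x.1 x.2).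
Proof.
have cV := computable_vec_code_add; have cO := computable_rule_output.
rewrite /step; computable_tac.
Qed.

Lemma computable_steps :
  computable (fun x : seq rule_code * config_code => steps x.1 x.2).
Proof. have cS := computable_step; rewrite /steps; computable_tac. Qed.

Lemma computable_window (d : nat) : computable (window d).
Proof.
have cS := computable_sums; apply: (@computable_ext _ _ _ _ (fun w =>
    (reach_window d w).2)).
  move=> w; suff -> : reach_window d w = (reach d w, window d w) by [].
  by elim: w => //= r w ->.
rewrite /reach_window; computable_tac.
Qed.

Lemma computable_patterns (n : nat) : computable (patterns n).
Proof. rewrite /patterns; computable_tac. Qed.

Lemma computable_table_inputs (n k : nat) : computable (table_inputs n k).
Proof.
have cP := computable_patterns n; rewrite /table_inputs; computable_tac.
Qed.

Lemma computable_same_result :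
  computable (fun x : (seq rule_code * seq rule_code) * (seq (seq nat) * config_code) =>
    same_result x.1.1 x.1.2 x.2.1 x.2.2).
Proof.
have cS := computable_steps; rewrite /same_result; computable_tac.
all: apply: computable_assoc; computable_tac.
Qed.

Lemma computable_same_action (d n k : nat) :
  computable (fun x : seq rule_code * seq rule_code => same_action d n k x.1 x.2).
Proof.
have cW := computable_window d; have cP := computable_patterns n.
rewrite /same_action; computable_tac.
apply: (computable_comp (f := fun x => ((x.1.1.1, x.1.1.2),
   (window d x.1.1.1 ++ window d x.1.1.2,
    (zip (window d x.1.1.1 ++ window d x.1.1.2) x.1.2, (nseq d 0, x.2)))))
  computable_same_result); computable_tac.
Qed.

Lemma computable_valid_rule (d n k : nat) : computable (valid_rule d n k).
Proof.
have cT := computable_table_inputs n k; rewrite /valid_rule; computable_tac.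
Qed.

(** * Correctness of the simulation *)

Definition vec_digits (d : nat) (v : vec d) : seq nat :=
  [seq code_int (v ord0 i) | i <- enum 'I_d].

Definition int_of_code (c : nat) : int := if odd c then Negz c./2 else Posz c./2.

Definition vec_of_digits (d : nat) (s : seq nat) : vec d :=
  (\row_(i < d) int_of_code (nth 0 s i))%R.

Lemma code_intK : cancel code_int int_of_code.
Proof.
by case=> m; rewrite /int_of_code /code_int /= odd_double ?uphalf_double ?doubleK.
Qed.

Lemma int_of_codeK : cancel int_of_code code_int.
Proof.
move=> c; rewrite /int_of_code -[RHS]odd_double_half; by case: (odd c).
Qed.

Lemma code_int_add (a b : int) :
  code_int (a + b)%R = int_code_add (code_int a) (code_int b).
Proof.
rewrite /int_code_add; case: a b => m [] m' /=; rewrite ?odd_double //=.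
- lia.
- case: (ltnP m' m) => lt.
    have -> : (Posz m + Negz m' = Posz (m - m'.+1))%R by lia.
    by rewrite /= ifT; lia.
  have -> : (Posz m + Negz m' = Negz (m' - m))%R by lia.
  by rewrite /= ifF; lia.
- case: (ltnP m m') => lt.
    have -> : (Negz m + Posz m' = Posz (m' - m.+1))%R by lia.
    by rewrite /= ifT; lia.
  have -> : (Negz m + Posz m' = Negz (m - m'))%R by lia.
  by rewrite /= ifF; lia.
- lia.
Qed.

Section Vectors.
Context (d : nat).
Implicit Types u v : vec d.

Lemma size_vec_digits v : size (vec_digits v) = d.
Proof. by rewrite size_map size_enum_ord. Qed.

Lemma vec_digitsK : cancel (@vec_digits d) (vec_of_digits d).
Proof.
move=> v; apply/rowP => i; rewrite mxE (nth_map i) ?size_enum_ord //.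
by rewrite nth_ord_enum code_intK.
Qed.

Lemma vec_digits_inj : injective (@vec_digits d).
Proof. exact: can_inj vec_digitsK. Qed.

Lemma vec_of_digitsK (s : seq nat) : size s = d -> vec_digits (vec_of_digits d s) = s.
Proof.
move=> sd; apply: (@eq_from_nth _ 0); first by rewrite size_vec_digits.
rewrite size_vec_digits => i lt_id; pose j := Ordinal lt_id.
by rewrite (nth_map j) ?size_enum_ord // mxE int_of_codeK nth_enum_ord.
Qed.

Lemma vec_digits0 : vec_digits (0%R : vec d) = nseq d 0.
Proof.
apply: (@eq_from_nth _ 0); first by rewrite size_vec_digits size_nseq.
rewrite size_vec_digits => i lt_id; pose j := Ordinal lt_id.
by rewrite (nth_map j) ?size_enum_ord // mxE nth_nseq lt_id.
Qed.

Lemma vec_digitsD u v :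
  vec_digits (u + v)%R = vec_code_add (vec_digits u) (vec_digits v).
Proof.
rewrite /vec_code_add zip_map -map_comp; apply: eq_map => i /=.
by rewrite mxE code_int_add.
Qed.

Lemma code_vecE v : code_vec v = enc (vec_digits v).
Proof. by rewrite /enc /= /seq_enc map_id. Qed.

End Vectors.

Section Assoc.
Context (K : eqType) (V : Type) (z : V).

Lemma assoc_cat_notin (x : K) (s t : seq (K * V)) :
  x \notin [seq y.1 | y <- s] -> assoc z x (s ++ t) = assoc z x t.
Proof.
by elim: s => //= y s IH; rewrite inE negb_or eq_sym => /andP[/negPf-> /IH].
Qed.

(** The tail [t] covers both a whole table, with [t] empty, and a tape whose new entries precede the
    old ones. *)
Lemma assoc_map (T : eqType) (key : T -> K) (out : T -> V) (s : seq T)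
    (t : seq (K * V)) a : injective key -> a \in s ->
  assoc z (key a) ([seq (key b, out b) | b <- s] ++ t) = out a.
Proof.
move=> key_inj; elim: s => //= b s IH; rewrite inE (inj_eq key_inj) eq_sym.
by case: eqP => [->|].
Qed.

End Assoc.

Lemma assoc_uniq (K V : eqType) (z : V) (s : seq (K * V)) x :
  uniq [seq y.1 | y <- s] -> x \in s -> assoc z x.1 s = x.2.
Proof.
elim: s => //= y s IH /andP[ys us]; rewrite inE => /predU1P[->|xs].
  by rewrite eqxx.
case: eqP => [e|_]; last exact: IH.
by case/negP: ys; rewrite e map_f.
Qed.

Lemma zip_map_id (S T : Type) (f : S -> T) (s : seq S) :
  zip s [seq f x | x <- s] = [seq (x, f x) | x <- s].
Proof. by elim: s => //= x s ->. Qed.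

Lemma mem_patterns (n m : nat) (p : seq nat) :
  (p \in patterns n m) = (size p == m) && all (fun x => x < n) p.
Proof.
elim: m p => [|m IH] p; first by rewrite inE; case: p.
apply/allpairsP/idP => [[[x q] /= [xn qm ->]]|].
  by move: xn qm; rewrite mem_iota IH /= eqSS => -> /andP[-> ->].
case: p => //= x p; rewrite eqSS => /andP[sp /andP[xn pn]].
by exists (x, p); split=> //; rewrite ?mem_iota //= IH sp.
Qed.

Lemma mem_table_inputs (n k m : nat) (x : seq nat * nat) :
  (x \in table_inputs n k m) =
  [&& size x.1 == m, all (fun i => i < n) x.1 & 0 < x.2 <= k].
Proof.
rewrite andbA -mem_patterns; apply/allpairsP/andP => [[[p q] /= [pm qk ->]]|].
  by move: qk; rewrite mem_iota /= add1n ltnS.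
by case: x => p q [pm qk]; exists (p, q); rewrite mem_iota add1n ltnS.
Qed.

(** * Simulation of one rule *)

Section Simulation.
Context (d n k : nat).
Local Open Scope ring_scope.
Implicit Types (f : local_rule d n k) (r : rule_code).

Definition pattern_digits (T : finType) (s : seq T) (p : {ffun T -> 'I_n}) : seq nat :=
  [seq val (p u) | u <- s].

Definition line_digits f (s : seq (read_set f)) (s' : seq (write_set f))
    (a : {ffun read_set f -> 'I_n} * state k) : line_code :=
  ((pattern_digits s a.1, val (val a.2)),
   ((pattern_digits s' (f a).1.1, val (val (f a).1.2)), vec_digits (f a).2)).

(** [codes_rule] before the lists are packed into numbers. *)
Definition represents r f : Prop :=
  exists (s : seq (read_set f)) (s' : seq (write_set f))
         (t : seq ({ffun read_set f -> 'I_n} * state k)),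
    [/\ enumerates s, enumerates s', enumerates t
      & r = (([seq vec_digits (val u) | u <- s], [seq vec_digits (val u) | u <- s']),
             [seq line_digits s s' a | a <- t])].

Lemma code_patternE (T : finType) (s : seq T) (p : {ffun T -> 'I_n}) :
  code_pattern s p = enc (pattern_digits s p).
Proof. by rewrite /enc /= /seq_enc map_id. Qed.

Lemma code_lineE f s s' a : code_line s s' a = enc (@line_digits f s s' a).
Proof.
case: a => p q; rewrite /line_digits /code_line.
by case: (f (p, q)) => -[p' q'] e; rewrite !code_patternE code_vecE.
Qed.

Lemma code_seq_map (T U : Type) {cU : coded U} (g : T -> U) (h : T -> nat) (s : seq T) :
  (forall x, h x = enc (g x)) -> code_seq [seq h x | x <- s] = enc [seq g x | x <- s].
Proof.
by move=> hg; rewrite /enc /= /seq_enc -map_comp; congr code_seq; apply: eq_map.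
Qed.

Lemma code_ruleE f (s : seq (read_set f)) (s' : seq (write_set f)) t :
  cpair (cpair (code_seq [seq code_vec (val u) | u <- s])
               (code_seq [seq code_vec (val u) | u <- s']))
        (code_seq [seq code_line s s' a | a <- t]) =
  enc (([seq vec_digits (val u) | u <- s], [seq vec_digits (val u) | u <- s']),
       [seq line_digits s s' a | a <- t]).
Proof.
rewrite (code_seq_map (g := fun u => vec_digits (val u)) s); last first.
  by move=> u; apply: code_vecE.
rewrite (code_seq_map (g := fun u => vec_digits (val u)) s'); last first.
  by move=> u; apply: code_vecE.
by rewrite (code_seq_map (g := line_digits s s')) // => a; apply: code_lineE.
Qed.

(** The backward direction rests on every number being a code, as [dec c] must determine [c]. *)
Lemma codes_ruleP (c : nat) f : codes_rule c f <-> represents (dec c) f.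
Proof.
split=> -[s [s' [t [es es' et e]]]]; exists s, s', t; split=> //.
  by rewrite e code_ruleE encK.
by rewrite code_ruleE -e; symmetry; apply: (@decK rule_code).
Qed.

Lemma pattern_digits_inj (T : finType) (s : seq T) :
  enumerates s -> injective (pattern_digits s).
Proof.
move=> [_ es] p p' /eq_in_map e; apply/ffunP => u.
by apply/val_inj/e.
Qed.

(** The list [x] uses coordinates centred at the starting position [V], the head being displaced by
    [e]. It is compared with [X] only on the cells read, since a finite list cannot describe a whole
    tape. *)
Lemma step_represents r f (x : tape_code) (e : vec d) (X : vec d -> 'I_n)
    (V : vec d) (q : state k) :
  represents r f ->
  (forall u : read_set f,
     assoc 0%N (vec_digits (e + val u)) x = X (V + (e + val u))) ->
  let o := f (pattern_at (read_set f) X (V + e), q) in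
  let c := step r (x, (vec_digits e, val (val q))) in
  c.2 = (vec_digits (e + o.2), val (val o.1.2)) /\
  forall t, assoc 0%N (vec_digits t) c.1 =
    if insub (t - e) is Some u then val (o.1.1 u) else assoc 0%N (vec_digits t) x.
Proof.
move=> [s [s' [t [es es' et ->]]]] xX o c.
have oE : rule_output (([seq vec_digits (val u) | u <- s],
      [seq vec_digits (val u) | u <- s']), [seq line_digits s s' a | a <- t])
    (x, (vec_digits e, val (val q))) =
    ((pattern_digits s' o.1.1, val (val o.1.2)), vec_digits o.2).
  rewrite /rule_output /= /line_digits.
  have -> : [seq assoc 0%N (vec_code_add (vec_digits e) u) x
            | u <- [seq vec_digits (val u) | u <- s]]
          = pattern_digits s (pattern_at (read_set f) X (V + e)).
    rewrite -map_comp; apply: eq_map => u /=.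
    by rewrite -vec_digitsD xX ffunE addrA.
  rewrite -[map _ t]cats0.
  apply: (@assoc_map _ _ _ _
    (fun a : {ffun read_set f -> 'I_n} * state k =>
       (pattern_digits s a.1, val (val a.2)))
    (fun a => ((pattern_digits s' (f a).1.1, val (val (f a).1.2)), vec_digits (f a).2))
    t [::] (pattern_at (read_set f) X (V + e), q)).
    by move=> [p1 q1] [p2 q2] /= [/(pattern_digits_inj es) -> /val_inj/val_inj ->].
  by case: et.
rewrite /c /step oE /= -vec_digitsD; split=> // v.
rewrite -map_comp /pattern_digits zip_map.
case: insubP => [u _ uv|ve].
  have -> : v = e + val u by rewrite uv addrC subrK.
  rewrite vec_digitsD.
  apply: (@assoc_map _ _ _ _
    (fun u : write_set f => vec_code_add (vec_digits e) (vec_digits (val u)))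
    (fun u => val (o.1.1 u))).
    move=> u1 u2; rewrite -!vec_digitsD => /vec_digits_inj /addrI; exact: val_inj.
  by case: es'.
rewrite assoc_cat_notin // -map_comp; apply: contra ve => /mapP[u _ /=].
by rewrite -vec_digitsD => /vec_digits_inj ->; rewrite addrC addKr; apply: valP.
Qed.
End Simulation.

(** * Products of rules and the window test *)

Section Words.
Context (d n k : nat).
Local Open Scope ring_scope.
Implicit Types (f : local_rule d n k) (r : rule_code) (fs gs : seq (local_rule d n k)).

Fixpoint represents_word (w : seq rule_code) fs : Prop :=
  match w, fs with
  | [::], [::] => True
  | r :: w', f :: fs' => represents r f /\ represents_word w' fs'
  | _, _ => False
  end.

(** [run] on configurations with a head, freed of the proof of uniqueness of the head; the headless
    ones are fixed by every rule. *)
Definition act f (a : (vec d -> 'I_n) * vec d * state k) :=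
  let o := f (pattern_at (read_set f) a.1.1 a.1.2, a.2) in
  (overwrite a.1.1 a.1.2 o.1.1, a.1.2 + o.2, o.1.2).

Definition acts fs a := foldr act a fs.

Definition runs fs (c : config d n k) := foldr (fun f c => run f c) c fs.

Lemma run_act f a : run f (with_head a.1.1 a.1.2 a.2) =
  with_head (act f a).1.1 (act f a).1.2 (act f a).2.
Proof. by rewrite run_with_head. Qed.

Lemma runs_acts fs a : runs fs (with_head a.1.1 a.1.2 a.2) =
  with_head (acts fs a).1.1 (acts fs a).1.2 (acts fs a).2.
Proof. by elim: fs => //= f fs ->; rewrite run_act. Qed.

Lemma runs_headless fs (c : config d n k) :
  (forall v, Defs.head c v = ord0) -> runs fs c = c.
Proof. by move=> c0; elim: fs => //= f fs ->; rewrite run_headless. Qed.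

Lemma with_head_inj (x x' : vec d -> 'I_n) v v' (q q' : state k) :
  with_head x v q = with_head x' v' q' -> [/\ x = x', v = v' & q = q'].
Proof.
move=> e; have := congr1 (fun c => Defs.head c v) e; rewrite /= eqxx.
case: eqP => [-> /val_inj ->|_ q0]; last by have := valP q; rewrite /= q0.
by have := congr1 (@tape d n k) e.
Qed.

Lemma eq_runs fs gs : (forall a, acts fs a = acts gs a) <-> runs fs = runs gs.
Proof.
split=> [e|e [[x v] q]].
  apply/funext => c; have [c0|[v [q ->]]] := headless_or_with_head c.
    by rewrite !runs_headless.
  by rewrite !(runs_acts _ (tape c, v, q)) e.
have := congr1 (@^~ (with_head x v q)) e; rewrite !(runs_acts _ (x, v, q)).
move=> /with_head_inj[].
by case: (acts fs _) (acts gs _) => [[? ?] ?] [[? ?] ?] /= -> -> ->.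
Qed.

(** Brings a listed code back to an actual cell. Both lists are treated at once because the window
    of a longer word is built from [reach]. *)
Lemma represents_window w fs t : represents_word w fs ->
  ((t \in reach d w) || (t \in window d w)) -> exists v : vec d, t = vec_digits v.
Proof.
elim: w fs t => [|r w IH] [|f fs] t //=.
  by move=> _; rewrite inE orbF => /eqP ->; exists 0; rewrite vec_digits0.
have sumP (s s' : seq (seq nat)) :
    (forall t, t \in s -> exists v : vec d, t = vec_digits v) ->
    (forall t, t \in s' -> exists v : vec d, t = vec_digits v) ->
    forall t, t \in sums s s' -> exists v : vec d, t = vec_digits v.
  move=> sP s'P u /allpairsP[[v v'] /= [/sP[a ->] /s'P[b ->] ->]].
  by exists (a + b); rewrite vec_digitsD.
move=> [[s [s' [l [_ _ _ ->]]]] wfs] /=; rewrite mem_cat => /orP[|/orP[|tw]].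
- apply: sumP => [u ru|u]; first by apply: IH wfs _; rewrite ru.
  by rewrite -map_comp => /mapP[a _ ->]; eexists.
- apply: sumP => [u ru|u]; first by apply: IH wfs _; rewrite ru.
  by rewrite mem_cat => /orP[] /mapP[a _ ->]; eexists.
- by apply: IH wfs _; rewrite tw orbT.
Qed.

Lemma mem_sums (s t : seq (seq nat)) v w :
  v \in s -> w \in t -> vec_code_add v w \in sums s t.
Proof. by move=> vs wt; apply/allpairsP; exists (v, w). Qed.

(** That [e] lies in [reach] puts the cells of the next letter in the window. Agreement of the tapes
    is propagated cell by cell, so the lemma serves when [x] covers just the window as well as when
    [X] is read off from [x] everywhere. *)
Lemma steps_represents w fs (x : tape_code) (X : vec d -> 'I_n) (V : vec d)
    (q : state k) :
  represents_word w fs ->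
  (forall t, vec_digits t \in window d w -> assoc 0%N (vec_digits t) x = X (V + t)) ->
  let c := steps w (x, (nseq d 0%N, val (val q))) in
  let a := acts fs (X, V, q) in
  exists e : vec d,
    [/\ c.2 = (vec_digits e, val (val a.2)), a.1.2 = V + e, vec_digits e \in reach d w,
        forall t, assoc 0%N (vec_digits t) x = X (V + t) ->
          assoc 0%N (vec_digits t) c.1 = a.1.1 (V + t)
      & forall t, vec_digits t \notin window d w -> a.1.1 (V + t) = X (V + t)].
Proof.
elim: w fs => [|r w IH] [|f fs] //=.
  by move=> _ _; exists 0; rewrite addr0 -vec_digits0 inE eqxx.
move=> [rf wfs] xX.
have [|e [ce ae re xa aX]] := IH _ wfs.
  by move=> t tw; apply: xX; rewrite mem_cat tw orbT.
have [s [s' [l [es es' el rE]]]] := rf.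
have in_window u : vec_digits u \in r.1.1 ++ r.1.2 ->
    vec_digits (e + u) \in sums (reach d w) (r.1.1 ++ r.1.2) ++ window d w.
  by move=> ur; rewrite mem_cat vec_digitsD mem_sums.
move: (steps w _) (acts fs _) => [y vq] [[Y V'] q'] /= in ce ae xa aX *; subst vq V'.
have [|c2 c1] := step_represents (x := y) (e := e) (X := Y) (V := V) q' rf.
  move=> u; apply/xa/xX/in_window; rewrite mem_cat; apply/orP; left.
  by rewrite rE /=; apply: map_f; case: es.
set o := f (pattern_at (read_set f) Y (V + e), q') in c1 c2 *.
have oE t : overwrite Y (V + e) o.1.1 (V + t) =
    if insub (t - e) is Some u then o.1.1 u else Y (V + t).
  by rewrite /overwrite opprD addrACA subrr add0r.
exists (e + o.2); split=> //=.
- by rewrite addrA.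
- rewrite vec_digitsD mem_sums // rE /= -map_comp; apply/mapP.
  by exists (pattern_at (read_set f) Y (V + e), q'); first by case: el.
- by move=> t xt; rewrite c1 oE; case: insub => // ; rewrite xa.
- move=> t tw; rewrite oE; case: insubP => [u _ ue|_]; last first.
    by apply: aX; apply: contra tw => tw; rewrite mem_cat tw orbT.
  case/negP: tw; have -> : t = e + val u by rewrite ue addrC subrK.
  apply: in_window; rewrite mem_cat; apply/orP; right.
  by rewrite rE /=; apply: map_f; case: es'.
Qed.

Lemma same_actionP u v fs gs : (0 < n)%N ->
  represents_word u fs -> represents_word v gs ->
  same_action d n k u v <-> (forall a, acts fs a = acts gs a).
Proof.
move=> n_gt0 ufs vgs; rewrite /same_action; set W := window d u ++ window d v.
have digitsW t : t \in W -> exists v : vec d, t = vec_digits v.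
  rewrite mem_cat => /orP[] tw.
    by apply: represents_window ufs _; rewrite tw orbT.
  by apply: represents_window vgs _; rewrite tw orbT.
split=> [/allP same [[X V] q]|same].
  (* What [X] shows on the window around [V]: one of the patterns tested. *)
  pose p := [seq val (X (V + vec_of_digits d t)) | t <- W].
  have /allP/(_ (val (val q))) :
      all (fun q => same_result u v W (zip W p, (nseq d 0%N, q))) (iota 1 k).
    apply: same; rewrite mem_patterns size_map eqxx /=.
    by apply/allP => _ /mapP[t _ ->]; apply: ltn_ord.
  have qk : val (val q) \in iota 1 k.
    by rewrite mem_iota add1n ltn_ord andbT lt0n; exact: valP q.
  move=> /(_ qk) /andP[/eqP same2 /allP same1].
  have pX t : vec_digits t \in W -> assoc 0%N (vec_digits t) (zip W p) = X (V + t).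
    move=> tW; rewrite /p zip_map_id -[map _ _]cats0.
    rewrite (@assoc_map _ _ _ _ id (fun t => val (X (V + vec_of_digits d t)))) //.
    by rewrite vec_digitsK.
  have [|e [ce ae _ xa aX]] := steps_represents (x := zip W p) (X := X) (V := V) q ufs.
    by move=> t tw; apply: pX; rewrite mem_cat tw.
  have [|e' [ce' ae' _ xa' aX']] :=
      steps_represents (x := zip W p) (X := X) (V := V) q vgs.
    by move=> t tw; apply: pX; rewrite mem_cat tw orbT.
  move: same2; rewrite ce ce' => -[/vec_digits_inj e_e' /val_inj/val_inj].
  have : (acts fs (X, V, q)).1.1 = (acts gs (X, V, q)).1.1.
    (* Inside [W] the test compares the cells; outside, neither word has changed them. *)
    apply/funext => t; have -> : t = V + (t - V) by rewrite addrC subrK.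
    have [tW|] := boolP (vec_digits (t - V) \in W); last first.
      by rewrite mem_cat negb_or => /andP[tu tv]; rewrite aX // aX'.
    by apply: val_inj; rewrite /= -xa ?pX // -xa' ?pX //; apply/eqP/same1.
  move: ae ae'; rewrite -e_e'.
  by case: (acts fs _) (acts gs _) => [[? ?] ?] [[? ?] ?] /= -> -> -> ->.
apply/allP => p; rewrite mem_patterns => /andP[/eqP sp /allP pn].
apply/allP => q; rewrite mem_iota add1n => /andP[q_gt0 q_le].
have Q0 : Ordinal q_le != ord0 by rewrite -val_eqE /= -lt0n.
pose Q : state k := Sub (Ordinal q_le) Q0.
have valQ : val (val Q) = q by [].
(* The default 0 is a letter since [n] is positive, so the tested list extends to a total tape. *)
have lt_n t : (assoc 0 t (zip W p) < n)%N.
  elim: W p sp pn {digitsW} => [|t' W IH] [|i p] //= [sp] pn.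
  case: eqP => _; first by apply: pn; rewrite inE eqxx.
  by apply: IH => // j jp; apply: pn; rewrite inE jp orbT.
pose X (t : vec d) := Ordinal (lt_n (vec_digits t)).
have pX t : assoc 0%N (vec_digits t) (zip W p) = X (0 + t) by rewrite add0r.
have [|e [ce ae _ xa _]] := steps_represents (x := zip W p) (X := X) (V := 0) Q ufs.
  by move=> t _.
have [|e' [ce' ae' _ xa' _]] := steps_represents (x := zip W p) (X := X) (V := 0) Q vgs.
  by move=> t _.
rewrite /same_result; move: ce ce'; rewrite valQ => ce ce'.
apply/andP; split.
  rewrite ce ce' same; have := ae; rewrite same ae' => /addrI -> //.
by apply/allP => _ /digitsW[t ->]; rewrite xa // xa' // same.
Qed.

End Words.

(** * Codes of local rules *)

Section Validity.
Context (d n k : nat) (hn : 0 < n) (hk : 0 < k).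
Implicit Types (f : local_rule d n k) (r : rule_code).

Lemma represents_valid r f : represents r f -> valid_rule d n k r.
Proof.
case=> s [s' [t [es es' et ->]]].
have uniq_digits (F : {fset vec d}) (s0 : seq F) : enumerates s0 ->
    uniq [seq vec_digits (val u) | u <- s0].
  by case=> us0 _; rewrite map_inj_uniq // => u v /vec_digits_inj/val_inj.
have inputP (T : finType) (s0 : seq T) (p : {ffun T -> 'I_n}) (q : state k) :
    (pattern_digits s0 p, val (val q)) \in table_inputs n k (size s0).
  rewrite mem_table_inputs size_map eqxx /= lt0n -ltnS ltn_ord (valP q) !andbT.
  by apply/allP => _ /mapP[u _ ->]; apply: ltn_ord.
have key_inj : injective (fun a : {ffun read_set f -> 'I_n} * state k =>
    (pattern_digits s a.1, val (val a.2))).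
  by move=> [p q] [p' q'] /= [/(pattern_digits_inj es) -> /val_inj/val_inj ->].
rewrite /valid_rule /= !size_map -andbA; apply/and4P; split.
- by apply/andP; split; apply: uniq_digits.
- rewrite all_cat !all_map; apply/andP.
  by split; apply/allP => u _ /=; rewrite size_vec_digits.
- rewrite -map_comp; apply/andP; split.
  + by rewrite map_inj_uniq //; case: et.
  + apply/allP => -[p q]; rewrite mem_table_inputs => /and3P[/= /eqP sp /allP pn].
    move=> /andP[q_gt0 q_le].
    (* The value at [u] stands in [p] at the rank of [u] in [s]; all entries are below [n], so the
       default of [insubd] does not show. *)
    pose p0 : {ffun read_set f -> 'I_n} :=
      [ffun u => insubd (Ordinal hn) (nth 0 p (index u s))].
    have Q0 : Ordinal (q_le : q < k.+1) != ord0 by rewrite -val_eqE /= -lt0n.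
    apply/mapP; exists (p0, Sub (Ordinal (q_le : q < k.+1)) Q0); first by case: et.
    congr pair; apply: (@eq_from_nth _ 0); first by rewrite size_map.
    move=> i lt_i; rewrite sp in lt_i.
    have [u0 _] : exists u0, u0 \in s.
      by case: (s) lt_i => // u; exists u; rewrite inE eqxx.
    rewrite (nth_map u0) // ffunE index_uniq //; last by case: es.
    by rewrite val_insubd pn // mem_nth // sp.
- apply/allP => _ /mapP[a _ ->] /=.
  by rewrite !inputP size_vec_digits eqxx.
Qed.

(** A finite set forgets the order of its elements, and a code depends on it; so [s] lists [F] in
    the order of [S]. *)
Lemma enumerate_digits (S : seq (seq nat)) :
  uniq S -> all (fun v => size v == d) S ->
  exists (F : {fset vec d}) (s : seq F),
    enumerates s /\ [seq vec_digits (val u) | u <- s] = S.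
Proof.
move=> uS /allP Sd; pose Sv := [seq vec_of_digits d v | v <- S].
have SvK : [seq vec_digits v | v <- Sv] = S.
  rewrite -map_comp -[RHS]map_id; apply/eq_in_map => v /Sd /eqP vd /=.
  exact: vec_of_digitsK.
have uSv : uniq Sv by apply: (@map_uniq _ _ (@vec_digits d)); rewrite SvK.
pose F := seq_fset tt Sv; pose s : seq F := pmap insub Sv.
have valS : [seq val u | u <- s] = Sv.
  rewrite (pmap_filter (@insubK _ _ F)) -[RHS]filter_predT; apply: eq_in_filter => v vS /=.
  by rewrite insubT // seq_fsetE.
exists F, s; split; last by rewrite -[RHS]SvK -valS -map_comp.
split=> [|u]; first by apply: (@map_uniq _ _ val); rewrite valS.
by rewrite -(mem_map val_inj) valS -(seq_fsetE tt); apply: valP.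
Qed.

(** The rule looks its values up in the table. Validity bounds all entries and covers all inputs, so
    no default value is ever reached. *)
Lemma valid_represents r : valid_rule d n k r -> exists f, represents r f.
Proof.
move=> /andP[/andP[/andP[uS uS'] dS] /andP[/andP[uT /allP inT] /allP T_ok]].
move: dS; rewrite all_cat => /andP[dS dS'].
have [F [s [es sE]]] := enumerate_digits uS dS.
have [F' [s' [es' s'E]]] := enumerate_digits uS' dS'.
pose pat (G : {fset vec d}) (t : seq G) (p : seq nat) : {ffun G -> 'I_n} :=
  [ffun u => insubd (Ordinal hn) (nth 0 p (index u t))].
have patK (G : {fset vec d}) (t : seq G) p : enumerates t -> size p = size t ->
    all (fun i => i < n) p -> pattern_digits t (pat G t p) = p.
  move=> et sp /allP pn; apply: (@eq_from_nth _ 0); first by rewrite size_map.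
  rewrite size_map => i lt_i.
  have [u0 _] : exists u0, u0 \in t.
    by case: (t) lt_i => // u; exists u; rewrite inE eqxx.
  rewrite (nth_map u0) // ffunE index_uniq //; last by case: et.
  by rewrite val_insubd pn // mem_nth // sp.
(* State 1 exists because [k] is positive; it is the default in [st]. *)
have q0P : inord 1 != ord0 :> 'I_k.+1 by rewrite -val_eqE /= inordK.
pose st (q : nat) : state k := insubd (Sub (inord 1) q0P) (inord q).
have stK q : 0 < q <= k -> val (val (st q)) = q.
  move=> /andP[q_gt0 q_le].
  by rewrite val_insubd -val_eqE /= inordK // -lt0n q_gt0 inordK.
pose f := @LocalRule d n k F F' (fun a =>
  let o := assoc (([::], 0), [::]) (pattern_digits s a.1, val (val a.2)) r.2 in
  (pat F' s' o.1.1, st o.1.2, vec_of_digits d o.2)).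
pose key (a : {ffun F -> 'I_n} * state k) := (pattern_digits s a.1, val (val a.2)).
pose arg (x : seq nat * nat) := (pat F s x.1, st x.2).
have szS : size r.1.1 = size s by rewrite -sE size_map.
have szS' : size r.1.2 = size s' by rewrite -s'E size_map.
have argK x : x \in table_inputs n k (size r.1.1) -> key (arg x) = x.
  rewrite mem_table_inputs => /and3P[/eqP sx xn xk].
  by rewrite /key /= patK ?stK // -?szS //; case: x {sx xn xk}.
have lineK l : l \in r.2 -> @line_digits _ _ _ f s s' (arg l.1) = l.
  move=> lr; have /and3P[l1 l2 /eqP ld] := T_ok _ lr.
  rewrite /line_digits -/(key _) /= -/(key (arg l.1)) argK //.
  rewrite (assoc_uniq _ uT lr); move: l2.
  rewrite mem_table_inputs => /and3P[/eqP sx xn xk].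
  by rewrite patK ?stK ?vec_of_digitsK -?szS' // -!surjective_pairing.
exists f, s, s', [seq arg l.1 | l <- r.2]; split=> //.
  have keyE : [seq key a | a <- [seq arg l.1 | l <- r.2]] = [seq l.1 | l <- r.2].
    rewrite -map_comp; apply/eq_in_map => l lr /=; apply: argK.
    by case/and3P: (T_ok _ lr).
  split=> [|a]; first by apply: (@map_uniq _ _ key); rewrite keyE.
  have : key a \in [seq l.1 | l <- r.2].
    apply: inT; rewrite mem_table_inputs szS size_map eqxx /= lt0n -ltnS ltn_ord.
    rewrite (valP a.2) !andbT.
    by apply/allP => _ /mapP[u _ ->]; apply: ltn_ord.
  rewrite -keyE mem_map // => -[p q] [p' q'].
  by case=> /(pattern_digits_inj es) -> /val_inj/val_inj ->.
rewrite sE s'E -map_comp [LHS]surjective_pairing [r.1]surjective_pairing; congr pair.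
by rewrite -[LHS]map_id; apply/eq_in_map => l lr /=; rewrite lineK.
Qed.

Lemma represents_exists f : exists r, represents r f.
Proof.
pose s := enum (predT : pred (read_set f)).
pose s' := enum (predT : pred (write_set f)).
pose t := enum (predT : pred ({ffun read_set f -> 'I_n} * state k)).
exists (([seq vec_digits (val u) | u <- s], [seq vec_digits (val u) | u <- s']),
  [seq line_digits s s' a | a <- t]), s, s', t.
by split=> //; split; rewrite ?enum_uniq // => u; rewrite mem_enum.
Qed.

End Validity.

(** * Word problems *)

Lemma eval_decision p x (b : bool) (P : Prop) :
  b <-> P -> eval p x (enc b) -> (P -> eval p x 1) /\ (~ P -> eval p x 0).
Proof. by case: b => -[bP Pb] e; split=> // h; [case: h; apply: bP | have := Pb h]. Qed.

(** * The monoid of Turing machines *)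

Section MonoidWords.
Context (d n k : nat) (hn : 0 < n) (hk : 0 < k).
Implicit Types (a b : TM d n k) (f : local_rule d n k) (w u v : seq rule_code).

Definition tm_of_rule f : TM d n k := MkTM (ex_intro _ f erefl).

Lemma presents_TMP (c : nat) a :
  presents_TM c a <-> exists2 f, represents (dec c) f & tm_fun a = run f.
Proof. by split=> -[f /codes_ruleP rf aE]; exists f => //; apply/codes_ruleP. Qed.

(** The decoded form of [monoid_word], with the rules of all letters chosen at once, as the window
    test requires. *)
Definition spells w a := exists2 fs, represents_word w fs & tm_fun a = runs fs.

Lemma spells_nil : spells [::] 1%g.
Proof. by exists [::]. Qed.

Lemma spells_cons r w a : spells (r :: w) a <->
  exists b b', [/\ presents_TM (enc r) b, spells w b' & a = (b * b')%g].
Proof.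
split=> [[[//|f fs] [rf wfs] aE]|[b [b' [/presents_TMP[f rf bE] [fs wfs b'E] ->]]]].
  have [b' b'E] : exists b' : TM d n k, tm_fun b' = runs fs.
    elim: fs {w wfs aE} => [|g gs [b' b'E]]; first by exists 1%g.
    by exists (tm_of_rule g * b')%g; rewrite /= b'E.
  exists (tm_of_rule f), b'; split; last by apply: TM_inj; rewrite aE /= b'E.
    by apply/presents_TMP; exists f => //; rewrite encK.
  by exists fs.
by exists (f :: fs); rewrite ?encK in rf *; [split | rewrite /= bE b'E].
Qed.

Lemma monoid_wordE (w : seq nat) a :
  monoid_word (@presents_TM d n k) w a <-> spells [seq dec c | c <- w] a.
Proof.
elim: w a => [|c w IH] a /=.
  by split=> [->|[[|f fs] // _ aE]]; [apply: spells_nil | apply: TM_inj].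
rewrite spells_cons decK.
by split=> -[b [b' [cb /IH wb' ->]]]; exists b, b'.
Qed.

Lemma same_action_spells u v a b : spells u a -> spells v b ->
  same_action d n k u v <-> a = b.
Proof.
move=> [fs ufs aE] [gs vgs bE]; rewrite (same_actionP hn ufs vgs) eq_runs -aE -bE.
by split=> [/TM_inj|->].
Qed.

Lemma spells1 (c : nat) a : presents_TM c a -> spells [:: dec c] a.
Proof.
move=> ca; apply/spells_cons; exists a, 1%g.
by split; [rewrite decK | apply: spells_nil | rewrite mulg1].
Qed.

Lemma presentation_TM : presentation (@presents_TM d n k).
Proof.
split=> [c a b /spells1 ca /spells1 cb|a].
  (* One word spells both [a] and [b]: its comparison with itself succeeds because [a = a], and
     success yields [a = b]. *)
  apply/(same_action_spells ca cb)/(same_action_spells ca ca).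
  by [].
have [f aE] := tm_funP a; have [r rf] := represents_exists f.
by exists (enc r); apply/presents_TMP; exists f; rewrite ?encK.
Qed.

Lemma valid_presents (c : nat) :
  valid_rule d n k (dec c) <-> exists a, presents_TM c a.
Proof.
split=> [/(valid_represents hn hk)[f cf]|[a /presents_TMP[f cf _]]].
  by exists (tm_of_rule f); apply/presents_TMP; exists f.
exact: represents_valid cf.
Qed.

Lemma all_valid_spells w : all (valid_rule d n k) w <-> exists a, spells w a.
Proof.
elim: w => [|r w IH] /=; first by split=> // _; exists 1%g; apply: spells_nil.
rewrite -{1}[r]encK; split=> [/andP[/valid_presents[b rb] /IH[b' wb']]|].
  by exists (b * b')%g; apply/spells_cons; exists b, b'.
move=> [a /spells_cons[b [b' [rb wb' _]]]]; apply/andP; split.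
  by apply/valid_presents; exists b.
by apply/IH; exists b'.
Qed.

Lemma code_word (w : seq nat) :
  code_seq w = enc [seq (dec c : rule_code) | c <- w].
Proof.
rewrite /enc /= /seq_enc -map_comp -[in LHS](map_id w); congr code_seq.
by apply: eq_map => c; symmetry; apply: (@decK rule_code).
Qed.

Lemma monoid_recursively_presented_TM :
  monoid_recursively_presented (@presents_TM d n k).
Proof.
split; first exact: presentation_TM.
  (* The set is decidable, so the certificate is a dummy number. *)
  have [|p pP] := enumerable_projection
    (r := fun (r : rule_code) (_ : nat) => valid_rule d n k r).
    have cV := computable_valid_rule d n k; computable_tac.
  exists p => c; rewrite -pP -valid_presents.
  by split=> [cv|[_ //]]; exists 0.
have [|p pP] := enumerable_projection
  (r := fun (x : seq rule_code * seq rule_code) (_ : nat) =>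
     [&& all (fun r => valid_rule d n k r) x.1, all (fun r => valid_rule d n k r) x.2
       & same_action d n k x.1 x.2]).
  have cV := computable_valid_rule d n k; have cS := computable_same_action d n k.
  computable_tac.
exists p => y; rewrite -pP; split=> [[u [v [-> [a [ua va]]]]]|].
  move/monoid_wordE: ua => ua; move/monoid_wordE: va => va.
  exists 0; rewrite !code_word -enc_pair encK /=.
  apply/and3P; split; try by apply/all_valid_spells; exists a.
  exact/(same_action_spells ua va).
move=> [_ /and3P[/all_valid_spells[a wa] /all_valid_spells[b wb] same]].
have ab := proj1 (same_action_spells wa wb) same; subst b.
set x : seq rule_code * seq rule_code := dec y in wa wb.
have decw (w : seq rule_code) : [seq dec c | c <- [seq enc r | r <- w]] = w.
  by rewrite -map_comp -[RHS]map_id; apply: eq_map => r; apply: encK.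
exists [seq enc r | r <- x.1], [seq enc r | r <- x.2]; split.
  by rewrite !code_word !decw -enc_pair -surjective_pairing decK.
by exists a; rewrite !monoid_wordE !decw.
Qed.

Lemma monoid_decidable_word_problem_TM :
  monoid_decidable_word_problem (@presents_TM d n k).
Proof.
have [p ep] := computable_same_action d n k; exists p => u v a b.
move=> /monoid_wordE ua /monoid_wordE vb x.
have same := same_action_spells ua vb; rewrite /x !code_word -enc_pair.
exact: eval_decision same (ep (_, _)).
Qed.

End MonoidWords.

(** * The group of reversible Turing machines *)

Section GroupWords.
Context (d n k : nat) (hn : 0 < n) (hk : 0 < k).
Implicit Types (a b : RTM d n k).

Notation letter := (nat * rule_code)%type.

(** An inverse is demanded whatever the sign, because a positive letter too must be shown to present
    a reversible machine. The bound by 1 rejects numbers that are not signs. *)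
Definition certified_letter (l : letter * rule_code) : bool :=
  [&& l.1.1 <= 1, valid_rule d n k l.1.2, valid_rule d n k l.2,
      same_action d n k [:: l.1.2; l.2] [::]
    & same_action d n k [:: l.2; l.1.2] [::]].

Definition certifies (w : seq letter) (m : seq (letter * rule_code)) : bool :=
  ([seq l.1 | l <- m] == w) && all certified_letter m.

Definition resolve (m : seq (letter * rule_code)) : seq rule_code :=
  [seq if l.1.1 == 1 then l.2 else l.1.2 | l <- m].

Definition group_letter (l : bool * nat) : letter := (nat_of_bool l.1, dec l.2).

Lemma code_group_wordE (w : seq (bool * nat)) :
  code_group_word w = enc [seq group_letter l | l <- w].
Proof.
rewrite /enc /= /seq_enc -map_comp /code_group_word; congr code_seq.
apply: eq_map => -[s c].
exact: (congr1 (cpair s) (esym (@decK rule_code _ _ c))).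
Qed.

Lemma spells2 (r r' : rule_code) (a b : TM d n k) :
  presents_TM (enc r) a -> presents_TM (enc r') b -> spells [:: r; r'] (a * b)%g.
Proof.
move=> ra rb; apply/spells_cons; exists a, b; split=> //.
by rewrite -[r']encK; apply: spells1.
Qed.

Lemma rtm_mulVg (a : RTM d n k) : (rtm_tm a^-1 * rtm_tm a = 1)%g.
Proof. by have /(congr1 (@rtm_tm d n k)) := mulVg a. Qed.

Lemma rtm_mulgV (a : RTM d n k) : (rtm_tm a * rtm_tm a^-1 = 1)%g.
Proof. by have /(congr1 (@rtm_tm d n k)) := mulgV a. Qed.

Lemma certified_letter_inverse s (c : nat) r' : certified_letter ((s, dec c), r') ->
  exists a : RTM d n k, presents_RTM c a /\ presents_TM (enc r') (rtm_tm a^-1%g).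
Proof.
move=> /and5P[_ /(@valid_presents d n k hn hk)[a ca]]; rewrite -{1}[r']encK.
move=> /(@valid_presents d n k hn hk)[b rb] ab ba.
rewrite -[c](@decK rule_code) in ca.
have abE : (a * b = 1)%g.
  exact/(same_action_spells hn (spells2 ca rb) (spells_nil _ _ _)).
have baE : (b * a = 1)%g.
  exact/(same_action_spells hn (spells2 rb ca) (spells_nil _ _ _)).
exists (MkRTM (ex_intro _ b (conj abE baE))); split.
  by rewrite /presents_RTM /= -[c](@decK rule_code).
(* The inverse in the group was picked by choice; uniqueness of two-sided inverses identifies it
   with [b]. *)
set A := MkRTM _; have AV : (rtm_tm A^-1 * a = 1)%g by exact: rtm_mulVg.
by rewrite -[rtm_tm _]mulg1 -abE mulgA AV mul1g.
Qed.

Lemma presentation_RTM : presentation (@presents_RTM d n k).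
Proof.
have [fn srj] := presentation_TM d k hn; split=> [c a b ca cb|a]; last exact: srj.
exact/RTM_inj/(fn c).
Qed.

(** Why the search for an inverse halts: the inverse machine also has a local rule, hence a code. *)
Lemma inverse_certified_letter (s : bool) (c : nat) (a : RTM d n k) :
  presents_RTM c a -> exists r', certified_letter (group_letter (s, c), r').
Proof.
move=> ca; have [c' ca'] := (presentation_TM d k hn).2 (rtm_tm a^-1%g).
exists (dec c'); apply/and5P; split.
- by case: s.
- by apply/(@valid_presents d n k hn hk); exists (rtm_tm a).
- by apply/(@valid_presents d n k hn hk); exists (rtm_tm a^-1%g).
- have caE : presents_TM (enc (dec c : rule_code)) (rtm_tm a) by rewrite decK.
  have ca'E : presents_TM (enc (dec c' : rule_code)) (rtm_tm a^-1%g) by rewrite decK.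
  apply/(same_action_spells hn (spells2 caE ca'E) (spells_nil _ _ _)).
  exact: rtm_mulgV.
- have caE : presents_TM (enc (dec c : rule_code)) (rtm_tm a) by rewrite decK.
  have ca'E : presents_TM (enc (dec c' : rule_code)) (rtm_tm a^-1%g) by rewrite decK.
  apply/(same_action_spells hn (spells2 ca'E caE) (spells_nil _ _ _)).
  exact: rtm_mulVg.
Qed.

Lemma group_word_certified (w : seq (bool * nat)) a :
  group_word (@presents_RTM d n k) w a ->
  exists m, certifies [seq group_letter l | l <- w] m.
Proof.
elim: w a => [|[s c] w IH] a /=; first by exists [::].
move=> [b [b' [cb /IH[m /andP[/eqP mw m_ok]] _]]].
have [r' lr'] := inverse_certified_letter s cb.
by exists ((group_letter (s, c), r') :: m); rewrite /certifies /= mw eqxx lr'.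
Qed.

(** A certificate alone ensures that all letters present reversible machines; the enumeration of
    identities has no promise to rely on. *)
Lemma certified_group_word (w : seq (bool * nat)) m :
  certifies [seq group_letter l | l <- w] m ->
  exists a, group_word (@presents_RTM d n k) w a /\ spells (resolve m) (rtm_tm a).
Proof.
elim: w m => [|[s c] w IH] [|[l r'] m] //.
  by exists 1%g; split=> //; apply: spells_nil.
rewrite /certifies /= eqseq_cons -andbA => /and4P[/eqP -> mw lr' m_ok].
have [|a [wa ma]] := IH m; first by rewrite /certifies mw.
have [b [cb rb]] := @certified_letter_inverse s c r' lr'.
exists ((if s then b^-1 else b) * a)%g; split; first by exists b, a.
apply/spells_cons; exists (rtm_tm (if s then b^-1 else b)%g), (rtm_tm a).
by split=> //; case: s {lr'} => //; rewrite [enc _](@decK rule_code).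
Qed.

Lemma group_word_fun (w : seq (bool * nat)) a b :
  group_word (@presents_RTM d n k) w a -> group_word (@presents_RTM d n k) w b -> a = b.
Proof.
elim: w a b => [|[s c] w IH] a b /=; first by move=> -> ->.
move=> [a1 [a2 [ca wa ->]]] [b1 [b2 [cb wb ->]]].
by rewrite (IH _ _ wa wb) ((presentation_RTM).1 c a1 b1 ca cb).
Qed.

Lemma resolve_group_word (w : seq (bool * nat)) m a :
  certifies [seq group_letter l | l <- w] m ->
  group_word (@presents_RTM d n k) w a -> spells (resolve m) (rtm_tm a).
Proof.
move=> /certified_group_word[b [wb mb]] wa.
by rewrite (group_word_fun wa wb).
Qed.

Notation certificate := (seq (letter * rule_code) * seq (letter * rule_code))%type.

Definition certifies2 (x : seq letter * seq letter) (m : certificate) :=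
  certifies x.1 m.1 && certifies x.2 m.2.

Definition resolved_same_action (m : certificate) :=
  same_action d n k (resolve m.1) (resolve m.2).

Lemma computable_certifies2 :
  computable (fun x : (seq letter * seq letter) * certificate => certifies2 x.1 x.2).
Proof.
have cS := computable_same_action d n k; have cV := computable_valid_rule d n k.
rewrite /certifies2 /certifies /certified_letter; computable_tac.
Qed.

Lemma computable_resolved_same_action : computable resolved_same_action.
Proof.
have cS := computable_same_action d n k.
rewrite /resolved_same_action /resolve; computable_tac.
Qed.

Lemma resolved_same_actionP (u v : seq (bool * nat)) m a b :
  certifies2 ([seq group_letter l | l <- u], [seq group_letter l | l <- v]) m ->
  group_word (@presents_RTM d n k) u a -> group_word (@presents_RTM d n k) v b ->
  resolved_same_action m <-> a = b.
Proof.
move=> /andP[mu mv] /(resolve_group_word mu) ua /(resolve_group_word mv) vb.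
by rewrite /resolved_same_action (same_action_spells hn ua vb); split=> [/RTM_inj|->].
Qed.

(** An arbitrary number decodes to letters whose signs are any numbers; the bound in the certificate
    makes them a genuine group word. *)
Lemma certifies_letters (w : seq letter) m : certifies w m ->
  exists w', w = [seq group_letter l | l <- w'].
Proof.
move=> /andP[/eqP <- m_ok]; exists [seq (l.1.1 == 1, enc l.1.2) | l <- m].
rewrite -map_comp; apply/eq_in_map => -[[s r] r'] /(allP m_ok) /andP[s1 _].
have s1E : nat_of_bool (s == 1) = s by case: s s1 => [|[]].
exact: (esym (congr2 pair s1E (encK r))).
Qed.

Lemma group_recursively_presented_RTM :
  group_recursively_presented (@presents_RTM d n k).
Proof.
have cC := computable_certifies2; have cR := computable_resolved_same_action.
split; first exact: presentation_RTM.
  (* Reversibility is certified by a rule for the inverse; the sign 0 is a placeholder. *)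
  have [|p pP] := enumerable_projection
      (r := fun r r' : rule_code => certified_letter ((0, r), r')).
    have cS := computable_same_action d n k; have cV := computable_valid_rule d n k.
    rewrite /certified_letter; computable_tac.
  exists p => c; rewrite -pP; split=> [[a /(inverse_certified_letter false)//]|[r']].
  by move=> /certified_letter_inverse[a [ca _]]; exists a.
have [|p pP] := enumerable_projection
  (r := fun (x : seq letter * seq letter) (m : certificate) =>
     certifies2 x m && resolved_same_action m); first by computable_tac.
exists p => y; rewrite -pP; split=> [[u [v [-> [a [ua va]]]]]|[m /andP[ok same]]].
  rewrite !code_group_wordE -enc_pair encK.
  have [[m mu] [m' mv]] := (group_word_certified ua, group_word_certified va).
  have ok : certifies2
      ([seq group_letter l | l <- u], [seq group_letter l | l <- v]) (m, m').
    by rewrite /certifies2 mu.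
  by exists (m, m'); rewrite ok; apply/(resolved_same_actionP ok ua va).
set x : seq letter * seq letter := dec y in ok.
have yE : y = enc x by rewrite decK.
move: x yE ok => [x1 x2] -> ok.
have /andP[/certifies_letters[u eu] /certifies_letters[v ev]] := ok.
rewrite /= in eu ev; subst x1 x2.
have /andP[/certified_group_word[a [ua _]] /certified_group_word[b [vb _]]] := ok.
have ab := proj1 (resolved_same_actionP ok ua vb) same; subst b.
by exists u, v; split; [rewrite !code_group_wordE | exists a].
Qed.

Lemma group_decidable_word_problem_RTM :
  group_decidable_word_problem (@presents_RTM d n k).
Proof.
have cC := computable_certifies2; have cR := computable_resolved_same_action.
have cD : computable (dec : nat -> certificate) by apply: computable_dec.
have [||p pP] := @computable_minimization (seq letter * seq letter) bool _ _
  (fun x m => certifies2 x (dec m)) (fun _ m => resolved_same_action (dec m)).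
- computable_tac.
- computable_tac.
exists p => u v a b ua vb x.
have [[m mu] [m' mv]] := (group_word_certified ua, group_word_certified vb).
(* [(m, m')] only shows that the search halts. The certificate [c] it returns may differ, but by
   [resolved_same_actionP] every certificate gives the same verdict. *)
have [|c ok] := (pP ([seq group_letter l | l <- u], [seq group_letter l | l <- v])).1.
  have mm' : certifies2
      ([seq group_letter l | l <- u], [seq group_letter l | l <- v]) (m, m').
    by rewrite /certifies2 mu.
  by exists (enc (m, m')); rewrite -[X in certifies2 _ X]encK in mm'.
rewrite /x !code_group_wordE -enc_pair.
exact: eval_decision (resolved_same_actionP ok ua vb).
Qed.

End GroupWords.

Theorem proposition9 (d n k : nat) (hd : 0 < d) (hn : 0 < n) (hk : 0 < k) :
  (monoid_recursively_presented (@presents_TM d n k) /\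
   monoid_decidable_word_problem (@presents_TM d n k)) /\
  (group_recursively_presented (@presents_RTM d n k) /\
   group_decidable_word_problem (@presents_RTM d n k)).
Proof.
split; split.
- exact: monoid_recursively_presented_TM.
- exact: monoid_decidable_word_problem_TM.
- exact: group_recursively_presented_RTM.
- exact: group_decidable_word_problem_RTM.
Qed.
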